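(* There exists a zero set $Z=(z_n)_{n\ge1}$ for the Dirichlet space $\mathcal{D}$ such that $\mathrm{cap}(\mathcal{E}(Z))>0$, where $$\mathcal{E}(Z)=\Big\{\zeta\in\mathbb{T}:\ \sum_{n=1}^\infty\frac{1-|z_n|^2}{|\zeta-z_n|^2}=\infty\Big\}.$$
   Context: $\mathbb{D}$ is the open unit disk and $\mathbb{T}$ the unit circle in $\mathbb{C}$. The Dirichlet space $\mathcal{D}$ is the set of analytic functions $f=\sum_{n\ge0}a_nz^n$ on $\mathbb{D}$ with $\int_{\mathbb{D}}|f'(z)|^2\,dA(z)=\sum_{n\ge1}n|a_n|^2<\infty$, where $dA=dx\,dy/\pi$. A sequence $(z_n)_{n\ge1}$ in $\mathbb{D}$ is a zero set for $\mathcal{D}$ if there is $f\in\mathcal{D}$, $f\not\equiv0$, with $f(z_n)=0$ for all $n\ge1$. The energy of a Borel probability measure $\mu$ on $\mathbb{T}$ is $I(\mu)=\iint\log\frac{1}{|\zeta-\xi|}\,d\mu(\zeta)\,d\mu(\xi)\in[0,\infty]$. For a Borel set $F\subset\mathbb{T}$, let $\mathcal{P}(F)$ be the set of Borel probability measures supported on a compact subset of $F$; the logarithmic capacity of $F$ is $\mathrm{cap}(F)=1/\inf\{I(\mu):\mu\in\mathcal{P}(F)\}$ (with $1/\infty=0$, $1/0=\infty$, $\inf\emptyset=\infty$). *)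

(* Defs.v *)
From HB Require Import structures.
From mathcomp Require Import all_boot all_order all_algebra.
From mathcomp Require Import all_classical all_reals all_analysis.
From mathcomp Require Import complex.

Set Implicit Arguments.
Unset Strict Implicit.
Unset Printing Implicit Defensive.
Import Order.TTheory GRing.Theory Num.Theory.
Import numFieldNormedType.Exports.
Local Open Scope classical_set_scope.
Local Open Scope ring_scope.

(* The usual topology of the complex plane, given by the modulus. *)
HB.instance Definition _ (R : realType) := NormedModule.copy R[i] (R[i]^o).

(* [`|z|] lives in R[i]; this is the modulus as an element of R. *)
Notation cmod := ComplexField.Normc.normc.

Definition unit_disk (R : realType) : set R[i] := [set z | cmod z < 1].

Definition unit_circle (R : realType) : set R[i] := [set z | cmod z = 1].

(* The functions f(z) = \sum_n a_n z^n on the open unit disk with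
   \sum_(n >= 1) n |a_n|^2 < +oo, the latter sum being the Dirichlet integral
   of f; values of f outside the disk are irrelevant. *)
Definition in_Dirichlet (R : realType) (f : R[i] -> R[i]) : Prop :=
  exists a : nat -> R[i],
    (forall z, unit_disk z -> series (fun n => a n * z ^+ n) @ \oo --> f z) /\
    (\sum_(1 <= n <oo) (n%:R * cmod (a n) ^+ 2)%:E < +oo)%E.

(* Sequences are indexed from 0.  A sequence enumerates a zero *set*, without
   repetition: no multiplicities are attached to the points, so a sequence with
   a point repeated infinitely often is not admitted. *)
Definition zero_set_Dirichlet (R : realType) (z : nat -> R[i]) : Prop :=
  [/\ injective z,
      (forall n, unit_disk (z n)) &
      exists f : R[i] -> R[i],
        [/\ in_Dirichlet f,
            (exists2 w, unit_disk w & f w != 0) &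
            forall n, f (z n) = 0]].

Definition exceptional_set (R : realType) (z : nat -> R[i]) : set R[i] :=
  [set zeta | unit_circle zeta /\
    (\sum_(0 <= n <oo)
       ((1 - cmod (z n) ^+ 2) / cmod (zeta - z n) ^+ 2)%:E = +oo)%E].

(* The complex plane with its Borel sigma-algebra. *)
Definition borelC (R : realType) := g_sigma_algebraType (@open R[i]).

(* log (1 / |zeta - xi|), equal to +oo on the diagonal. *)
Definition log_kernel (R : realType) (zeta xi : R[i]) : \bar R :=
  if zeta == xi then +oo%E else (ln (1 / cmod (zeta - xi)))%:E.

Definition log_energy (R : realType) (mu : probability (borelC R) R) : \bar R :=
  (\int[mu]_xi \int[mu]_zeta log_kernel zeta xi)%E.

(* Borel probability measures supported on a compact subset of F; for F in the
   unit circle these are the Borel probability measures on the circle with that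
   property, extended by 0 to the plane. *)
Definition compact_probabilities (R : realType) (F : set R[i]) :
    set (probability (borelC R) R) :=
  [set mu | exists K : set R[i], [/\ compact K, K `<=` F & mu (~` K) = 0%E]].

(* [ereal_inf set0 = +oo], and the inverse on [\bar R] satisfies
   [0^-1 = +oo] and [+oo^-1 = 0]. *)
Definition log_capacity (R : realType) (F : set R[i]) : \bar R :=
  ((ereal_inf [set log_energy mu | mu in compact_probabilities F])^-1)%E.

(* Main.v *)
From HB Require Import structures.
Require Import Defs.
From mathcomp Require Import all_boot all_order all_algebra.
From mathcomp Require Import all_classical all_reals all_analysis.
From mathcomp Require Import complex.
From mathcomp Require Import cyclic separable cyclotomic.
From mathcomp Require Import measurable_realfun.
From mathcomp Require Import ring lra.

(** The zeros accumulate on a Cantor subset [K] of the circle that is large for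
    logarithmic capacity but so thin that a Dirichlet function can be extremely
    small near it.

    The set.  Let [G x = 1/16 \sum_k floor (2 ^ k x) / 4 ^ k].  This function is
    strictly increasing, and at level [m] its values on [0 <= x < 1] fall into
    [2 ^ m] clusters of size about [4 ^ -m].  Let [K] be the image, under the
    Cayley transform, of the closure of the values on [0 <= x <= 1/2].  Since
    [|G x - G y| >= (x - y) ^ 2 / 64] when [|x - y| <= 1]
    ([cantor_limit_expand]), the image of the uniform measure gives mass
    [O(2 ^ -i)] to every disk of radius [4 ^ -i], hence has bounded logarithmic
    potential and finite energy ([mu_disk_le], [log_energy_cantor]).

    The zeros.  Write [N = i + 1 = 2 ^ m + j] with [j < 2 ^ m], let [w_i] be the
    point of the circle attached to the dyadic number [j / 2 ^ m], and put the zero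
    [q_i = (1 - b_i) w_i] at depth [b_i = 1 / (2 N ^ 2)], which is of order
    [4 ^ -m].  Every point of [K] is within [O(4 ^ -m)] of some [w_i] of level
    [m], and the corresponding Poisson term is of order [4 ^ m]; so the terms are
    unbounded on [K] ([exceptional_cayley]).

    The function.  Put poles [p_i = (1 + a_i) w_i] outside the disk, with
    [a_i = 256 / N ^ 2], and consider [F_k = \prod_(i < k) (z - q_i) / (z - p_i)].
    On the circle each factor has modulus at most [1], and at most [1/16] within
    [O(4 ^ -m)] of [w_i].  A point of the circle at distance about [4 ^ -n] from
    the set of the [w_i] meets one such small factor at each of the levels below
    [n], so there [|F_k| <= 16 ^ -n]: the product is bounded by the square of the
    distance to the zeros ([small_or_far]).  The logarithmic derivative of [F_k]
    is of order [\sum_i (a_i + b_i)] over that same square, whence a bound on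
    [F_k'] on the circle that does not depend on [k]; similarly
    [F_k.+1 - F_k = O(a_k + b_k)].  Parseval turns these two bounds into
    convergence of the Taylor coefficients and finiteness of
    [\sum_n n ^ 2 |a_n| ^ 2] ([Dirichlet_limit]).  The limit vanishes at all the
    [q_i], and not at [0] because [\sum_i (a_i + b_i)] converges.  To keep to
    finite sums, [F_k] is replaced by a polynomial close to it together with its
    derivative on the closed disk.

    The capacity.  It is the inverse of an infimum of energies.  The measure
    above makes the infimum finite.  It is nonnegative because the zeros lie
    above a short arc, so that the exceptional set has diameter at most [1] and
    the kernel is nonnegative on it ([exceptional_diameter]). *)

Set Implicit Arguments.
Unset Strict Implicit.
Unset Printing Implicit Defensive.
Import Order.TTheory GRing.Theory Num.Theory.
Import numFieldNormedType.Exports.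
Local Open Scope classical_set_scope.
Local Open Scope ring_scope.
Local Open Scope complex_scope.

(** * The modulus *)

Section Modulus.
Variable R : realType.
Implicit Types z w : R[i].

Lemma normr_cmod z : `|z| = (cmod z)%:C.
Proof. by case: z. Qed.

Lemma cmod0 : cmod (0 : R[i]) = 0.
Proof. exact: ComplexField.Normc.normc0. Qed.

Lemma cmod1 : cmod (1 : R[i]) = 1.
Proof. exact: ComplexField.Normc.normc1. Qed.

Lemma cmod_ge0 z : 0 <= cmod z.
Proof. by case: z => a b; rewrite sqrtr_ge0. Qed.

Lemma sqr_cmod z : cmod z ^+ 2 = complex.Re z ^+ 2 + complex.Im z ^+ 2.
Proof. by case: z => a b /=; rewrite sqr_sqrtr // addr_ge0 // sqr_ge0. Qed.

Lemma cmodM z w : cmod (z * w) = cmod z * cmod w.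
Proof. exact: ComplexField.Normc.normcM. Qed.

Lemma cmodV z : cmod z^-1 = (cmod z)^-1.
Proof. exact: ComplexField.Normc.normcV. Qed.

Lemma cmodD z w : cmod (z + w) <= cmod z + cmod w.
Proof. by rewrite -lecR rmorphD /= -!normr_cmod ler_normD. Qed.

Lemma cmodN z : cmod (- z) = cmod z.
Proof. by apply: (@complexI R); rewrite -!normr_cmod normrN. Qed.

Lemma cmodB z w : cmod (z - w) = cmod (w - z).
Proof. by rewrite -cmodN opprB. Qed.

Lemma cmodB_trans y z w : cmod (z - w) <= cmod (z - y) + cmod (y - w).
Proof. by apply: le_trans (cmodD _ _); rewrite addrA subrK. Qed.

Lemma cmod_sum (I : Type) (r : seq I) (P : pred I) (F : I -> R[i]) :
  cmod (\sum_(i <- r | P i) F i) <= \sum_(i <- r | P i) cmod (F i).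
Proof.
elim/big_rec2: _ => [|i y x _ le_xy]; first by rewrite cmod0.
by apply: le_trans (cmodD _ _) _; rewrite lerD2l.
Qed.

Lemma cmod_prod (I : Type) (r : seq I) (P : pred I) (F : I -> R[i]) :
  cmod (\prod_(i <- r | P i) F i) = \prod_(i <- r | P i) cmod (F i).
Proof.
by elim/big_rec2: _ => [|i y x _ <-]; rewrite ?cmod1 ?cmodM.
Qed.

Lemma cmodX z n : cmod (z ^+ n) = cmod z ^+ n.
Proof. by apply: (@complexI R); rewrite -normr_cmod normrX normr_cmod rmorphXn. Qed.

Lemma cmod_real (x : R) : cmod x%:C = `|x|.
Proof. by rewrite /= expr0n /= addr0 sqrtr_sqr. Qed.

Lemma cmod_eq0 z : (cmod z == 0) = (z == 0).
Proof.
by apply/eqP/eqP => [/ComplexField.Normc.eq0_normc //|->]; exact: cmod0.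
Qed.

Lemma cmod_gt0 z : (0 < cmod z) = (z != 0).
Proof. by rewrite lt_def cmod_ge0 andbT cmod_eq0. Qed.

Lemma normRe_le z : `|complex.Re z| <= cmod z.
Proof. by rewrite -lecR -normr_cmod normc_ge_Re. Qed.

Lemma normIm_le z : `|complex.Im z| <= cmod z.
Proof.
by rewrite -[leRHS]ger0_norm ?cmod_ge0 // -!sqrtr_sqr sqr_cmod ler_wsqrtr // lerDr sqr_ge0.
Qed.

Lemma cmod_le_ReIm z : cmod z <= `|complex.Re z| + `|complex.Im z|.
Proof.
rewrite -(ler_pXn2r (n := 2)) // ?nnegrE ?cmod_ge0 ?addr_ge0 //.
rewrite sqr_cmod sqrrD !real_normK ?num_real // -addrA lerD2l lerDr.
by rewrite mulrn_wge0 // mulr_ge0.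
Qed.

Lemma cmod_conj z : (cmod z ^+ 2)%:C = z * z^*.
Proof. by rewrite rmorphXn /= -normr_cmod sqr_normc. Qed.

End Modulus.

Section Parseval.
Variable R : realType.

(** Over an algebraically closed field of characteristic [0], [X ^ n - 1] is
    separable, hence has enough roots for one of them to be primitive. *)
Lemma complex_prim_root n : (0 < n)%N -> exists w : R[i], n.-primitive_root w.
Proof.
move=> n_gt0; pose p : {poly R[i]} := 'X^n - 1.
have [rs Dp] := closed_field_poly_normal p.
move: Dp; rewrite (monicP _) ?monicXnsubC // scale1r => Dp.
have rsn : all n.-unity_root rs.
  by apply/allP => x; rewrite -root_prod_XsubC -Dp.
have urs : uniq rs.
  rewrite -separable_prod_XsubC -Dp separable_Xn_sub_1 //.
  by rewrite pnatr_eq0 -lt0n.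
have size_rs : (n <= size rs)%N.
  by rewrite -ltnS -(size_prod_XsubC rs id) -Dp size_XnsubC.
have /hasP[w _ wn] := has_prim_root n_gt0 rsn urs size_rs.
by exists w.
Qed.

Lemma cmod_unity_root n (w : R[i]) : (0 < n)%N -> w ^+ n = 1 -> cmod w = 1.
Proof.
move=> n_gt0 wn; apply/eqP; rewrite -(pexpr_eq1 n_gt0 (cmod_ge0 _)) -cmodX wn.
by rewrite cmod1.
Qed.

(** Averaging [|p| ^ 2] over the roots of unity of an order exceeding the degree
    isolates the diagonal of the double sum, so the mean is exactly the sum of
    the squared moduli of the coefficients. *)
Lemma sum_sqr_coef_le (p : {poly R[i]}) (B : R) :
  (forall z, cmod z = 1 -> cmod p.[z] <= B) ->
  \sum_(i < size p) cmod p`_i ^+ 2 <= B ^+ 2.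
Proof.
move=> pB; set n := size p.
have [w wn] := complex_prim_root (ltn0Sn n).
have w1 j : cmod (w ^+ j) = 1.
  apply: (@cmod_unity_root n.+1) => //.
  by rewrite exprAC (prim_expr_order wn) expr1n.
have conjw j : (w ^+ j)^* = (w ^+ j)^-1.
  have := cmod_conj (w ^+ j); rewrite w1 expr1n rmorph1 => /esym e.
  by apply: (@mulfI _ (w ^+ j)); rewrite ?mulfV -?cmod_eq0 ?w1 ?oner_eq0.
have w_neq0 : w != 0 by rewrite -cmod_eq0 -[w]expr1 w1 oner_eq0.
have orth (a b : 'I_n) :
    \sum_(j < n.+1) (w ^+ a / w ^+ b) ^+ j = if a == b then n.+1%:R else 0.
  have [->|ab] := eqVneq a b.
    rewrite divff ?expf_neq0 //.
    under eq_bigr do rewrite expr1n.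
    by rewrite sumr_const card_ord.
  have ne : w ^+ a / w ^+ b - 1 != 0.
    rewrite subr_eq0; apply/eqP => /divr1_eq/eqP.
    rewrite (eq_prim_root_expr wn) !modn_small ?ltnS ?(ltnW (ltn_ord _)) //.
    exact/negP.
  apply: (mulfI ne); rewrite -subrX1 mulr0 expr_div_n -!exprM.
  by rewrite ![(_ * n.+1)%N]mulnC !exprM (prim_expr_order wn) !expr1n divr1 subrr.
have key : \sum_(j < n.+1) (cmod p.[w ^+ j] ^+ 2)%:C
         = n.+1%:R * \sum_(i < n) (cmod p`_i ^+ 2)%:C.
  transitivity (\sum_(j < n.+1) \sum_(a < n) \sum_(b < n)
      p`_a * (p`_b)^* * (w ^+ a / w ^+ b) ^+ j).
    apply: eq_bigr => j _; rewrite cmod_conj horner_coef rmorph_sum big_distrl.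
    apply: eq_bigr => a _; rewrite big_distrr; apply: eq_bigr => b _ /=.
    transitivity (p`_a * w ^+ j ^+ a * ((p`_b)^* * (w ^- j) ^+ b)).
      congr (_ * _); rewrite rmorphM rmorphXn /=.
      by congr (_ * _ ^+ _); exact: conjw.
    rewrite expr_div_n -!exprVn -!exprM ![(_ * j)%N]mulnC.
    by ring.
  rewrite exchange_big big_distrr; apply: eq_bigr => a _ /=.
  rewrite exchange_big (bigD1 a) //= [X in _ + X]big1 ?addr0 => [|b ba].
    by rewrite -big_distrr /= orth eqxx cmod_conj mulrC.
  by rewrite -big_distrr /= orth eq_sym (negPf ba) mulr0.
have : n.+1%:R * \sum_(i < n) cmod p`_i ^+ 2 <= n.+1%:R * B ^+ 2.
  rewrite -lecR rmorphM rmorph_nat rmorph_sum /= -key -rmorph_sum lecR.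
  apply: le_trans (_ : \sum_(j < n.+1) B ^+ 2 <= _).
    apply: ler_sum => j _; rewrite ler_sqr ?nnegrE ?cmod_ge0 ?pB //.
    exact: le_trans (cmod_ge0 _) (pB 1 (cmod1 _)).
  by rewrite sumr_const card_ord mulr_natl.
by rewrite ler_pM2l // ltr0n.
Qed.

(** One term of the Parseval sum: this stands in for the Cauchy estimates. *)
Lemma cmod_coef_le (p : {poly R[i]}) (B : R) i :
  (forall z, cmod z = 1 -> cmod p.[z] <= B) -> cmod p`_i <= B.
Proof.
move=> pB.
have B0 : 0 <= B by exact: le_trans (cmod_ge0 _) (pB 1 (cmod1 _)).
have [lti|ltp] := ltnP i (size p); last first.
  by rewrite nth_default // cmod0.
rewrite -ler_sqr ?nnegrE ?cmod_ge0 //.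
apply: le_trans (sum_sqr_coef_le pB).
rewrite (bigD1 (Ordinal lti)) //= lerDl.
by apply: sumr_ge0 => j _; rewrite exprn_ge0 // cmod_ge0.
Qed.

End Parseval.

(** * Limits in the plane and in the Dirichlet space *)

Section ComplexLimits.
Variable R : realType.

(** Working with [sup] of the lower bounds [x k - e k] gives the limit together
    with the explicit rate, for an arbitrary modulus of convergence. *)
Lemma real_cauchy_limit (x e : nat -> R) :
  (forall k l, `|x k - x l| <= e k + e l) -> exists L, forall k, `|x k - L| <= e k.
Proof.
move=> xe; pose A := [set x k - e k | k in [set: nat]].
have A0 : A !=set0 by exists (x 0%N - e 0%N), 0%N.
have ubA k : ubound A (x k + e k).
  move=> _ [l _ <-]; have := xe l k; rewrite ler_norml => /andP[_]; lra.
have supA : has_sup A by split=> //; exists (x 0%N + e 0%N).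
exists (sup A) => k.
have h1 : sup A <= x k + e k by exact: ge_sup.
have h2 : x k - e k <= sup A by apply: ub_le_sup; [case: supA|exists k].
by rewrite ler_norml; apply/andP; split; lra.
Qed.

Lemma complex_cauchy_limit (u : nat -> R[i]) (e : nat -> R) :
  (forall k l, cmod (u k - u l) <= e k + e l) ->
  exists L, forall k, cmod (u k - L) <= 2 * e k.
Proof.
move=> ue.
have [x xP] : exists x, forall k, `|complex.Re (u k) - x| <= e k.
  apply: real_cauchy_limit => k l; apply: le_trans (ue k l).
  by have := normRe_le (u k - u l); case: (u k) (u l) => ? ? [].
have [y yP] : exists y, forall k, `|complex.Im (u k) - y| <= e k.
  apply: real_cauchy_limit => k l; apply: le_trans (ue k l).
  by have := normIm_le (u k - u l); case: (u k) (u l) => ? ? [].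
exists (x +i* y) => k; apply: le_trans (cmod_le_ReIm _) _.
rewrite mulr_natl mulr2n.
by have := xP k; have := yP k; case: (u k) => a b /= ? ?; apply: lerD.
Qed.

Lemma cvg_complex (u : nat -> R[i]) (e : nat -> R) (L : R[i]) :
  (forall k, cmod (u k - L) <= e k) -> e @ \oo --> 0 -> u @ \oo --> L.
Proof.
move=> ue e0; apply/cvgrPdist_lt => eps eps0.
have epsE : eps = (complex.Re eps)%:C by rewrite RRe_real // gtr0_real.
have eps'0 : 0 < complex.Re eps by rewrite -ltcR -epsE.
have H := cvgr_lt _ e0 _ eps'0; near=> k.
rewrite normr_cmod epsE ltcR cmodB.
by apply: le_lt_trans (ue k) _; near: k; exact: H.
Unshelve. all: by end_near.

Qed.

Lemma le_of_cvg0 (x y : R) (e : nat -> R) N :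
  (forall n, (N <= n)%N -> x <= y + e n) -> e @ \oo --> 0 -> x <= y.
Proof.
move=> xy e0; apply/ler_addgt0Pr => d d0.
have [M _ MP] := cvgr_lt _ e0 _ d0.
apply: le_trans (xy (maxn N M) (leq_maxl _ _)) _.
by rewrite lerD2l ltW // MP //= leq_maxr.
Qed.

Lemma cvg_geom0 (A r : R) : 0 <= r -> r < 1 -> (fun n => A * r ^+ n) @ \oo --> 0.
Proof.
move=> r0 r1; rewrite -[X in _ --> X](mulr0 A).
by apply: cvgM; [exact: cvg_cst | apply: cvg_expr; rewrite ger0_norm].
Qed.

Lemma sum_geom_le (r : R) m n : 0 <= r -> r < 1 ->
  \sum_(m <= i < n) r ^+ i <= r ^+ m / (1 - r).
Proof.
move=> r0 r1; have r1' : 0 < 1 - r by rewrite subr_gt0.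
have [mn|nm] := leqP m n; last first.
  by rewrite big_geq ?(ltnW nm) // divr_ge0 ?exprn_ge0 ?(ltW r1').
rewrite ler_pdivlMr // mulrBr mulr1 mulr_suml -sumrB.
under eq_bigr do rewrite -exprSr.
rewrite (telescope_sumr_eq (fun i => - r ^+ i)) // => [|i _]; last first.
  by rewrite opprK addrC.
by rewrite opprK addrC lerBlDr lerDl exprn_ge0.
Qed.

Lemma horner_bounded (p : {poly R[i]}) :
  exists2 B, 0 <= B & forall z, cmod z <= 1 -> cmod p.[z] <= B.
Proof.
exists (\sum_(i < size p) cmod p`_i) => [|z z1].
  by apply: sumr_ge0 => i _; exact: cmod_ge0.
rewrite horner_coef; apply: le_trans (cmod_sum _ _ _) _.
apply: ler_sum => i _; rewrite cmodM cmodX ler_piMr ?cmod_ge0 //.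
by rewrite exprn_ile1 // cmod_ge0.
Qed.

Lemma cvg_inv_nat (A : R) : (fun n => A / n.+1%:R) @ \oo --> 0.
Proof.
rewrite -[X in _ --> X](mulr0 A).
by apply: cvgM; [exact: cvg_cst | exact: cvg_harmonic].
Qed.

End ComplexLimits.

Section DirichletLimit.
Variables (R : realType) (p : nat -> {poly R[i]}) (C : R).
Hypothesis C0 : 0 <= C.
Hypothesis p_step : forall k z, cmod z = 1 ->
  cmod ((p k.+1).[z] - (p k).[z]) <= C / k.+1%:R - C / k.+2%:R.
Hypothesis p_deriv : forall k z, cmod z = 1 -> cmod (p k)^`().[z] <= C.

Let coef_cauchy m k l :
  cmod ((p k)`_m - (p l)`_m) <= C / k.+1%:R + C / l.+1%:R.
Proof.
have e0 n : 0 <= C / n.+1%:R by rewrite divr_ge0.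
wlog kl : k l / (k <= l)%N.
  by move=> W; have [/W //|/ltnW/W] := leqP k l; rewrite cmodB [leRHS]addrC.
rewrite cmodB -coefB; apply: le_trans (_ : C / k.+1%:R - C / l.+1%:R <= _).
  apply: cmod_coef_le => z z1; rewrite hornerE hornerN.
  elim: l kl => [|l IH]; first by rewrite leqn0 => /eqP ->; rewrite !subrr cmod0.
  rewrite leq_eqVlt => /predU1P[->|]; first by rewrite !subrr cmod0.
  rewrite ltnS => /IH kl; apply: le_trans (cmodB_trans (p l).[z] _ _) _.
  by apply: le_trans (lerD (p_step l z1) kl) _; rewrite addrC addrA subrK.
by rewrite lerD2l (le_trans _ (e0 l)) // oppr_le0.
Qed.

(** The bound on consecutive differences makes the coefficients Cauchy,
    uniformly in the degree; the bound on the derivatives bounds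
    [\sum_n n ^ 2 |a_n| ^ 2] through Parseval, which is more than the Dirichlet
    integral needs. *)
Lemma Dirichlet_limit : exists f : R[i] -> R[i], in_Dirichlet f /\
  forall k z, unit_disk z -> cmod ((p k).[z] - f z) <= 2 * C / k.+1%:R / (1 - cmod z).
Proof.
have /choice[a aP] : forall m, exists L, forall k,
    cmod ((p k)`_m - L) <= 2 * (C / k.+1%:R).
  by move=> m; apply: complex_cauchy_limit => k l; exact: coef_cauchy.
have [A A0 aA] : exists2 A, 0 <= A & forall m, cmod (a m) <= A.
  have [B B0 BP] := horner_bounded (p 0%N).
  exists (B + 2 * C) => [|m]; first by rewrite addr_ge0 // mulr_ge0.
  have h1 : cmod ((p 0%N)`_m) <= B by apply: cmod_coef_le => z z1; apply: BP; rewrite z1.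
  have h2 := aP m 0%N; rewrite invr1 mulr1 in h2.
  have := cmodB_trans (p 0%N)`_m (a m) 0; rewrite !subr0 [cmod (a m - _)]cmodB; lra.
pose S z : nat -> R[i] := series (fun n => a n * z ^+ n).
have /choice[f fP] : forall z, exists L, unit_disk z ->
    forall n, cmod (S z n - L) <= 2 * (A / (1 - cmod z) * cmod z ^+ n).
  move=> z; have [zD|nzD] := pselect (unit_disk z); last by exists 0.
  have z1 : 0 < 1 - cmod z by rewrite subr_gt0.
  have [|L LP] := @complex_cauchy_limit R (S z) (fun n => A / (1 - cmod z) * cmod z ^+ n).
    have e0 n : 0 <= A / (1 - cmod z) * cmod z ^+ n.
      by rewrite mulr_ge0 ?exprn_ge0 ?cmod_ge0 // divr_ge0 // ltW.
    move=> k l; wlog kl : k l / (k <= l)%N.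
      by move=> W; have [/W //|/ltnW/W] := leqP k l; rewrite cmodB [leRHS]addrC.
    rewrite cmodB /S sub_series_geq //; apply: le_trans (cmod_sum _ _ _) _.
    apply: le_trans (_ : A * \sum_(k <= i < l) cmod z ^+ i <= _).
      rewrite big_distrr; apply: ler_sum => i _.
      by rewrite cmodM cmodX ler_wpM2r // exprn_ge0 // cmod_ge0.
    apply: le_trans (_ : A / (1 - cmod z) * cmod z ^+ k <= _).
      rewrite -mulrA [_^-1 * _]mulrC ler_wpM2l // sum_geom_le ?cmod_ge0 //.
    by rewrite lerDl.
  by exists L.
exists f; split; last first.
  move=> k z zD; have z1 : 0 < 1 - cmod z by rewrite subr_gt0.
  apply: (@le_of_cvg0 _ _ _ (fun n => 2 * (A / (1 - cmod z) * cmod z ^+ n)) (size (p k))).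
    move=> n pn; apply: le_trans (cmodB_trans (S z n) _ _) _.
    apply: lerD; last exact: fP.
    rewrite (horner_coef_wide _ pn) /S /series /= big_mkord -sumrB.
    apply: le_trans (cmod_sum _ _ _) _.
    apply: le_trans (_ : \sum_(i < n) 2 * (C / k.+1%:R) * cmod z ^+ i <= _).
      apply: ler_sum => i _; rewrite -mulrBl cmodM cmodX ler_wpM2r //.
      by rewrite exprn_ge0 // cmod_ge0.
    rewrite -mulr_sumr -[2 * C / _]mulrA ler_wpM2l ?mulr_ge0 ?divr_ge0 //.
    have := @sum_geom_le _ (cmod z) 0 n (cmod_ge0 z) zD.
    by rewrite big_mkord expr0 mul1r.
  under eq_fun do rewrite mulrA.
  by apply: cvg_geom0 => //; exact: cmod_ge0.
exists a; split.
  move=> z zD; apply: cvg_complex (fP z zD) _.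
  under eq_fun do rewrite mulrA.
  by apply: cvg_geom0 => //; exact: cmod_ge0.
have bnd N : \sum_(1 <= n < N) n%:R * cmod (a n) ^+ 2 <= 2 * C ^+ 2 + 8 * C ^+ 2.
  have derivP : \sum_(0 <= n < N) n%:R ^+ 2 * cmod (p N)`_n ^+ 2 <= C ^+ 2.
    have := sum_sqr_coef_le (p_deriv N); apply: le_trans.
    have -> : \sum_(i < size (p N)^`()) cmod (p N)^`()`_i ^+ 2 =
       \sum_(i < maxn N (size (p N)^`())) cmod (p N)^`()`_i ^+ 2.
      rewrite (big_ord_widen _ (fun i => cmod (p N)^`()`_i ^+ 2) (leq_maxr N _)).
      rewrite [RHS](bigID (fun i : 'I__ => (i < size (p N)^`())%N)) /=.
      rewrite [X in _ + X]big1 ?addr0 // => i; rewrite -leqNgt => h.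
      by rewrite nth_default // cmod0 expr0n.
    rewrite -(big_mkord xpredT (fun i => cmod (p N)^`()`_i ^+ 2)).
    rewrite [leRHS](big_cat_nat (n := N)) ?leq_maxl //=.
    case: N => [|N].
      rewrite ![\sum_(0 <= _ < 0) _]big_geq // add0r.
      by apply: sumr_ge0 => *; rewrite sqr_ge0.
    rewrite big_nat_recl // expr0n mul0r add0r.
    apply: le_trans (_ : \sum_(0 <= i < N.+1) cmod (p N.+1)^`()`_i ^+ 2 <= _); last first.
      by rewrite lerDl sumr_ge0 // => *; rewrite sqr_ge0.
    rewrite [leRHS]big_nat_recr //= ler_wpDr ?sqr_ge0 //.
    apply: ler_sum => i _; rewrite coef_deriv -(mulr_natl (p N.+1)`_i.+1) cmodM exprMn.
    by rewrite -(rmorph_nat (real_complex R)) cmod_real normr_nat.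
  apply: le_trans (_ : \sum_(0 <= n < N) n%:R * cmod (a n) ^+ 2 <= _).
    case: N {derivP} => [|N]; first by rewrite !big_geq.
    by rewrite [leRHS]big_nat_recl // mul0r add0r big_add1.
  (* The [N]-th polynomial has an error [O(1 / N)] in each coefficient, which
     contributes a bounded amount to the sum of the first [N] terms. *)
  apply: le_trans (_ : \sum_(0 <= n < N) (2 * (n%:R ^+ 2 * cmod (p N)`_n ^+ 2) +
       8 * C ^+ 2 / N.+1%:R ) <= _).
    rewrite !big_nat; apply: ler_sum => n /andP[_ nN].
    have N0 : 0 < N.+1%:R :> R by [].
    have nN' : n%:R <= N.+1%:R :> R by rewrite ler_nat leqW ?(ltnW nN).
    have n2 : n%:R <= n%:R ^+ 2 :> R.
      by rewrite -natrX ler_nat; case: (n) => // ?; rewrite leq_pmulr.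
    have ha : cmod (a n) <= cmod (p N)`_n + 2 * C / N.+1%:R.
      have := aP n N; rewrite cmodB.
      have := cmodB_trans (p N)`_n (a n) 0; rewrite !subr0 -mulrA.
      by move: (C / _) => c; lra.
    have hb : cmod (a n) ^+ 2 <= 2 * cmod (p N)`_n ^+ 2 + 8 * C ^+ 2 / N.+1%:R ^+ 2.
      apply: le_trans (_ : (cmod (p N)`_n + 2 * C / N.+1%:R) ^+ 2 <= _).
        by rewrite ler_sqr ?nnegrE ?addr_ge0 ?divr_ge0 ?mulr_ge0 ?cmod_ge0.
      have -> : 8 * C ^+ 2 / N.+1%:R ^+ 2 = 2 * (2 * C / N.+1%:R) ^+ 2.
        by field; rewrite lt0r_neq0.
      move: (cmod (p N)`_n) (2 * C / N.+1%:R) => x y.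
      by have := sqr_ge0 (x - y); rewrite sqrrB sqrrD; lra.
    apply: le_trans (ler_wpM2l (ler0n _ n) hb) _.
    rewrite mulrDr; apply: lerD.
      by rewrite mulrCA ler_wpM2l // ler_wpM2r ?sqr_ge0.
    rewrite mulrCA ler_wpM2l ?mulr_ge0 ?sqr_ge0 // ler_pdivrMr ?exprn_gt0 //.
    by rewrite expr2 mulKf ?lt0r_neq0.
  rewrite big_split /= -mulr_sumr; apply: lerD; first by rewrite ler_wpM2l.
  rewrite sumr_const_nat subn0 -[_ *+ N]mulr_natr -mulrA ler_piMr ?mulr_ge0 ?sqr_ge0 //.
  by rewrite mulrC ler_pdivrMr // mul1r ler_nat.
apply: (@le_lt_trans _ _ (2 * C ^+ 2 + 8 * C ^+ 2)%:E); last exact: ltry.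
apply: lime_le.
  by apply: is_cvg_nneseries => n _ _; rewrite lee_fin mulr_ge0 // sqr_ge0.
by apply: nearW => N; rewrite sumEFin lee_fin.
Qed.

End DirichletLimit.

(** * Polynomial approximation on the closed disk *)

Section PolynomialApproximation.
Variable R : realType.

(** [g] plays the part of the derivative of [f]: it is a uniform limit of
    derivatives of polynomials converging uniformly to [f]. *)
Definition poly_approx (f g : R[i] -> R[i]) := forall e : R, 0 < e ->
  exists p : {poly R[i]}, forall z, cmod z <= 1 ->
    cmod (p.[z] - f z) <= e /\ cmod (p^`().[z] - g z) <= e.

Lemma poly_approx_poly (p : {poly R[i]}) :
  poly_approx (fun z => p.[z]) (fun z => p^`().[z]).
Proof.
by move=> e /ltW e0; exists p => z _; rewrite !subrr cmod0.
Qed.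

Lemma poly_approx_ext f g f' g' :
  (forall z, cmod z <= 1 -> f z = f' z) -> (forall z, cmod z <= 1 -> g z = g' z) ->
  poly_approx f g -> poly_approx f' g'.
Proof.
move=> ff gg fg e /fg[p pP]; exists p => z z1.
by rewrite -ff // -gg //; exact: pP.
Qed.

Lemma poly_approx_bounded f g : poly_approx f g ->
  exists2 B, 0 <= B & forall z, cmod z <= 1 -> cmod (f z) <= B /\ cmod (g z) <= B.
Proof.
move=> /(_ _ ltr01)[p pP].
have [B B0 pB] := horner_bounded p; have [B' B'0 pB'] := horner_bounded p^`().
exists (B + B' + 1) => [|z z1]; first by rewrite !addr_ge0.
have [h1 h2] := pP z z1; have := pB z z1; have := pB' z z1.
have := cmodB_trans p.[z] (f z) 0; rewrite !subr0 [cmod (f z - _)]cmodB.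
have := cmodB_trans p^`().[z] (g z) 0; rewrite !subr0 [cmod (g z - _)]cmodB.
by split; lra.
Qed.

Lemma poly_approxM f g f' g' : poly_approx f g -> poly_approx f' g' ->
  poly_approx (fun z => f z * f' z) (fun z => g z * f' z + f z * g' z).
Proof.
move=> fg fg' e e0.
have [B B0 BP] := poly_approx_bounded fg.
have [B' B'0 B'P] := poly_approx_bounded fg'.
pose d := Num.min 1 (e / (2 * (B + B' + 1))).
have D0 : 0 < 2 * (B + B' + 1) by lra.
have d0 : 0 < d by rewrite lt_min ltr01 divr_gt0.
have d1 : d <= 1 by rewrite ge_min lexx.
have de : d * (2 * (B + B' + 1)) <= e.
  by rewrite -ler_pdivlMr // ge_min lexx orbT.
have [p pP] := fg d d0; have [q qP] := fg' d d0.
have prod_err x y x' y' : cmod (x - x') <= d -> cmod (y - y') <= d ->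
    cmod x' <= B + B' -> cmod y' <= B + B' -> forall E,
    cmod x' + cmod y' + 1 <= E ->
    cmod (x * y - x' * y') <= d * E.
  move=> hx hy bx by' E hE.
  have -> : x * y - x' * y' = (x - x') * (y - y') + (x - x') * y' + x' * (y - y').
    by ring.
  apply: le_trans (cmodD _ _) _; apply: le_trans (lerD (cmodD _ _) (lexx _)) _.
  rewrite !cmodM.
  have := cmod_ge0 x'; have := cmod_ge0 y'; have := cmod_ge0 (x - x').
  have := cmod_ge0 (y - y').
  move: (cmod x') (cmod y') (cmod (x - x')) (cmod (y - y')) hx hy hE => u v a b.
  by move=> *; nra.
exists (p * q) => z z1.
have [p1 p2] := pP z z1; have [q1 q2] := qP z z1.
have [b1 b2] := BP z z1; have [b3 b4] := B'P z z1.
have sB u v : u <= B -> v <= B' -> u <= B + B' /\ v <= B + B' by move=> *; split; lra.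
split; rewrite ?derivM !hornerE.
  apply: le_trans (_ : d * (B + B' + 1) <= _); last by nra.
  by apply: prod_err => //; lra.
rewrite opprD addrACA; apply: le_trans (cmodD _ _) _.
apply: le_trans (_ : d * (B + B' + 1) + d * (B + B' + 1) <= _); last by lra.
by apply: lerD; apply: prod_err => //; lra.
Qed.

(** With [s ^ 2 = r], the sequence is [s ^ n] times [n s ^ n], and the latter is
    at most the geometric sum of ratio [s]. *)
Lemma cvg_nat_geom0 (r : R) : 0 <= r -> r < 1 -> (fun n => n%:R * r ^+ n) @ \oo --> 0.
Proof.
move=> r0 r1; pose s := Num.sqrt r.
have s0 : 0 <= s by exact: sqrtr_ge0.
have rs : r = s * s by rewrite -expr2 sqr_sqrtr.
have s1 : s < 1 by rewrite -sqrtr1 ltr_sqrt.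
have s1' : 0 < 1 - s by lra.
apply: (@squeeze_cvgr _ _ _ _ (fun=> 0) (fun n => (1 - s)^-1 * s ^+ n)).
- near=> n; rewrite mulr_ge0 ?exprn_ge0 //= rs exprMn mulrA ler_wpM2r ?exprn_ge0 //.
  apply: le_trans (_ : \sum_(0 <= i < n) s ^+ i <= _); last first.
    by apply: le_trans (sum_geom_le _ _ s0 s1) _; rewrite expr0 mul1r.
  apply: le_trans (_ : \sum_(i < n) s ^+ n <= _).
    by rewrite sumr_const card_ord mulr_natl.
  by rewrite big_mkord; apply: ler_sum => i _; rewrite ler_wiXn2l // ?ltW // ltnW.
- exact: cvg_cst.
- by apply: cvg_geom0.
Unshelve. all: by end_near.
Qed.

(** The partial sums [p] of the geometric series satisfy
    [(1 - u X) p = 1 - (u X) ^ N]; differentiating this identity controls the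
    error on the derivative as well. *)
Lemma poly_approx_geom (u : R[i]) : cmod u < 1 ->
  poly_approx (fun z => (1 - u * z)^-1) (fun z => u / (1 - u * z) ^+ 2).
Proof.
move=> u1 e e0; set r := cmod u; have r0 : 0 <= r := cmod_ge0 u.
have r1 : 0 < 1 - r by rewrite subr_gt0.
have c1 : (fun n => r ^+ n / (1 - r)) @ \oo --> 0.
  by under eq_fun do rewrite mulrC; apply: cvg_geom0.
have c2 : (fun n => (r ^+ n / (1 - r) + n%:R * r ^+ n.-1) / (1 - r)) @ \oo --> 0.
  rewrite -[X in _ --> X](mul0r (1 - r)^-1); apply: cvgMl.
  rewrite -[X in _ --> X](addr0 0); apply: cvgD c1 _.
  rewrite -cvg_shiftS.
  suff : (fun n => n.+1%:R * r ^+ n) @ \oo --> 0 by [].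
  have -> : (fun n => n.+1%:R * r ^+ n) = (fun n => n%:R * r ^+ n) \+ (fun n => 1 * r ^+ n).
    by apply: funext => n /=; rewrite -natr1 mulrDl.
  by rewrite -[X in _ --> X]addr0; exact: cvgD (cvg_nat_geom0 r0 u1) (cvg_geom0 1 r0 u1).
have [N [N1 N2]] : exists N, r ^+ N / (1 - r) <= e /\
    (r ^+ N / (1 - r) + N%:R * r ^+ N.-1) / (1 - r) <= e.
  have [N1 _ H1] := cvgr_le _ c1 _ e0; have [N2 _ H2] := cvgr_le _ c2 _ e0.
  by exists (maxn N1 N2); split; [apply: H1|apply: H2]; rewrite /= ?leq_maxl ?leq_maxr.
pose p : {poly R[i]} := \sum_(i < N) (u *: 'X) ^+ i.
have pE : (1 - u *: 'X) * p = 1 - (u *: 'X) ^+ N.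
  by rewrite -[LHS]opprK -mulNr opprB -subrX1 opprB.
have := congr1 deriv pE.
rewrite derivM !derivB derivZ derivX deriv_exp derivZ derivX derivC !sub0r => dpE.
exists p => z z1.
have uz : cmod (u * z) <= r by rewrite cmodM ler_piMr.
have uz1 : 1 - r <= cmod (1 - u * z).
  have := cmodB_trans (u * z) 1 0; rewrite !subr0 cmod1; lra.
have nz : 1 - u * z != 0 by rewrite -cmod_gt0 (lt_le_trans r1).
have e1 : p.[z] - (1 - u * z)^-1 = - (u * z) ^+ N / (1 - u * z).
  have E := congr1 (fun q => q.[z]) pE; rewrite !hornerE in E.
  by apply: (mulfI nz); rewrite mulrBr E; field.
have e2 : p^`().[z] - u / (1 - u * z) ^+ 2 =
    (u * (- (u * z) ^+ N / (1 - u * z)) - N%:R * (u * (u * z) ^+ N.-1)) / (1 - u * z).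
  have E := congr1 (fun q => q.[z]) dpE; rewrite !(hornerE, hornerMn) in E.
  rewrite -e1; apply: (mulfI nz); apply: (addrI (- u * p.[z])).
  rewrite mulrBr addrA E -mulr_natl; clear -nz.
  by field; exact: nz.
have b1 : cmod ((u * z) ^+ N) <= r ^+ N by rewrite cmodX lerXn2r ?nnegrE ?cmod_ge0.
have b2 : cmod ((u * z) ^+ N.-1) <= r ^+ N.-1 by rewrite cmodX lerXn2r ?nnegrE ?cmod_ge0.
have iv : (cmod (1 - u * z))^-1 <= (1 - r)^-1 by rewrite lef_pV2 // posrE cmod_gt0.
have b3 : cmod (- (u * z) ^+ N / (1 - u * z)) <= r ^+ N / (1 - r).
  by rewrite cmodM cmodN cmodV ler_pM ?cmod_ge0 // invr_ge0 cmod_ge0.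
split; first by rewrite e1; apply: le_trans N1.
rewrite e2; apply: le_trans N2; rewrite cmodM cmodV.
rewrite ler_pM ?cmod_ge0 ?invr_ge0 ?cmod_ge0 //.
apply: le_trans (cmodD _ _) _; rewrite cmodN; apply: lerD.
  by rewrite cmodM (le_trans _ b3) // ler_piMl ?cmod_ge0 // ltW.
rewrite !cmodM -(rmorph_nat (real_complex R)) cmod_real normr_nat ler_wpM2l //.
by rewrite (le_trans _ b2) // ler_piMl ?cmod_ge0 // ltW.
Qed.

End PolynomialApproximation.

(** * Products of factors with a zero inside and a pole outside the disk *)

Section CircleGeometry.
Variable R : realType.

Lemma cmod1_le (z : R[i]) : cmod z = 1 -> cmod z <= 1.
Proof. by move->. Qed.

(** A zero and a pole on the ray through [w] are thus compared with each other,
    and with [w], through the single quantity [cmod (z - w)]. *)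
Lemma sqr_cmod_ray (z w : R[i]) (r : R) : cmod z = 1 -> cmod w = 1 ->
  cmod (z - r%:C * w) ^+ 2 = (1 - r) ^+ 2 + r * cmod (z - w) ^+ 2.
Proof.
move=> z1 w1; have := sqr_cmod z; have := sqr_cmod w; rewrite {}z1 {}w1 !sqr_cmod.
case: z w => [x y] [u v] /=; rewrite !mul0r subr0 addr0 expr1n => W Z.
apply/eqP; rewrite -subr_eq0; apply/eqP.
transitivity ((1 - r) * (x ^+ 2 + y ^+ 2) + (r ^+ 2 - r) * (u ^+ 2 + v ^+ 2) - (1 - r) ^+ 2).
  by ring.
by rewrite -Z -W; ring.
Qed.

Variables z w : R[i].
Hypotheses (z1 : cmod z = 1) (w1 : cmod w = 1).
Implicit Types a b : R.

Let zero_dist b :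
  cmod (z - (1 - b)%:C * w) ^+ 2 = b ^+ 2 + (1 - b) * cmod (z - w) ^+ 2.
Proof. by rewrite sqr_cmod_ray // subKr. Qed.

Let pole_dist a :
  cmod (z - (1 + a)%:C * w) ^+ 2 = a ^+ 2 + (1 + a) * cmod (z - w) ^+ 2.
Proof. by rewrite sqr_cmod_ray // opprD addNKr sqrrN. Qed.

Lemma dist_zero_le_pole a b : 0 <= b -> b <= a ->
  cmod (z - (1 - b)%:C * w) <= cmod (z - (1 + a)%:C * w).
Proof.
move=> b0 ba; rewrite -ler_sqr ?nnegrE ?cmod_ge0 // zero_dist pole_dist.
have := sqr_ge0 (cmod (z - w)); move: (cmod (z - w) ^+ 2) => t t0.
have : b ^+ 2 <= a ^+ 2 by nra.
have : 0 <= (a + b) * t by rewrite mulr_ge0 //; lra.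
lra.
Qed.

Lemma dist_zero_ge_half b : b <= 1 / 2 -> cmod (z - w) / 2 <= cmod (z - (1 - b)%:C * w).
Proof.
move=> b2; rewrite -ler_sqr ?nnegrE ?cmod_ge0 ?divr_ge0 ?cmod_ge0 // zero_dist exprMn.
by have := sqr_ge0 (cmod (z - w)); move: (cmod (z - w) ^+ 2) => t t0; nra.
Qed.

Lemma dist_zero_ge_depth b : 0 <= b -> b <= 1 / 2 -> b <= cmod (z - (1 - b)%:C * w).
Proof.
move=> b0 b2; rewrite -ler_sqr ?nnegrE ?cmod_ge0 // zero_dist.
by have := sqr_ge0 (cmod (z - w)); move: (cmod (z - w) ^+ 2) => t t0; nra.
Qed.

Lemma dist_pole_ge_depth a : 0 <= a -> a <= cmod (z - (1 + a)%:C * w).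
Proof.
move=> a0; rewrite -ler_sqr ?nnegrE ?cmod_ge0 // pole_dist.
by have := sqr_ge0 (cmod (z - w)); move: (cmod (z - w) ^+ 2) => t t0; nra.
Qed.

Lemma sqr_dist_zero_le b : 0 <= b ->
  cmod (z - (1 - b)%:C * w) ^+ 2 <= b ^+ 2 + cmod (z - w) ^+ 2.
Proof.
move=> b0; rewrite zero_dist.
by have := sqr_ge0 (cmod (z - w)); move: (cmod (z - w) ^+ 2) => t t0; nra.
Qed.

End CircleGeometry.

Section Product.
Variables (R : realType) (w : nat -> R[i]) (a b : nat -> R).
Hypothesis w1 : forall i, cmod (w i) = 1.
Hypothesis b0 : forall i, 0 < b i.
Hypothesis b2 : forall i, b i <= 1 / 2.
Hypothesis ba : forall i, b i <= a i.

Definition zero_pt i : R[i] := (1 - b i)%:C * w i.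
Definition pole_pt i : R[i] := (1 + a i)%:C * w i.
Definition factor i (z : R[i]) := (z - zero_pt i) / (z - pole_pt i).
Definition factor' i (z : R[i]) := (zero_pt i - pole_pt i) / (z - pole_pt i) ^+ 2.
Definition finprod k (z : R[i]) := \prod_(i < k) factor i z.
Fixpoint finprod' k (z : R[i]) : R[i] :=
  if k is k'.+1 then finprod' k' z * factor k' z + finprod k' z * factor' k' z else 0.

Let a0 i : 0 < a i. Proof. exact: lt_le_trans (ba i). Qed.

Lemma cmod_zero_pt i : cmod (zero_pt i) = 1 - b i.
Proof. by rewrite cmodM w1 mulr1 cmod_real ger0_norm //; have := b2 i; lra. Qed.

Lemma cmod_pole_pt i : cmod (pole_pt i) = 1 + a i.
Proof. by rewrite cmodM w1 mulr1 cmod_real ger0_norm //; have := a0 i; lra. Qed.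

Lemma cmod_zero_sub_pole i : cmod (zero_pt i - pole_pt i) = a i + b i.
Proof.
rewrite -mulrBl cmodM w1 mulr1 -rmorphB cmod_real ler0_norm.
  by ring.
by have := a0 i; have := b0 i; lra.
Qed.

Lemma pole_pt_neq i z : cmod z <= 1 -> z - pole_pt i != 0.
Proof.
move=> z1; rewrite subr_eq0; apply/eqP => zp.
by have := a0 i; move: z1; rewrite zp cmod_pole_pt; lra.
Qed.

Lemma zero_pt_neq i z : cmod z = 1 -> z - zero_pt i != 0.
Proof.
move=> z1; rewrite subr_eq0; apply/eqP => zp.
by have := b0 i; move: z1; rewrite zp cmod_zero_pt; lra.
Qed.

Lemma finprodS k z : finprod k.+1 z = finprod k z * factor k z.
Proof. exact: big_ord_recr. Qed.

Lemma finprod_zero_pt k i : (i < k)%N -> finprod k (zero_pt i) = 0.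
Proof.
move=> ik; apply/eqP; rewrite prodf_seq_eq0; apply/hasP.
by exists (Ordinal ik); rewrite ?mem_index_enum //= /factor subrr mul0r.
Qed.

Lemma cmod_factor_le1 i z : cmod z = 1 -> cmod (factor i z) <= 1.
Proof.
move=> z1; rewrite cmodM cmodV ler_pdivrMr ?cmod_gt0 ?pole_pt_neq ?z1 // mul1r.
by apply: dist_zero_le_pole => //; exact: ltW.
Qed.

Lemma poly_approx_factor i : poly_approx (factor i) (factor' i).
Proof.
pose u := (pole_pt i)^-1.
have p0 : pole_pt i != 0 by rewrite -cmod_gt0 cmod_pole_pt; have := a0 i; lra.
have u1 : cmod u < 1 by rewrite cmodV cmod_pole_pt invf_lt1; have := a0 i; lra.
have uz z : cmod z <= 1 -> 1 - u * z != 0.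
  move=> z1; have -> : 1 - u * z = - u * (z - pole_pt i) by rewrite /u; field.
  by rewrite mulf_neq0 ?pole_pt_neq // oppr_eq0 invr_neq0.
have := poly_approxM (poly_approx_poly ((- u) *: ('X - (zero_pt i)%:P)))
  (poly_approx_geom u1).
apply: poly_approx_ext => z z1; rewrite !hornerE ?derivZ ?derivB ?derivX ?derivC ?hornerE.
  by rewrite /factor /u; have h1 := pole_pt_neq i z1;
    field; rewrite h1 p0 -opprB oppr_eq0 h1.
transitivity (- u * (1 - 0) / (1 - u * z)
              + - u * (z - zero_pt i) * u / (1 - u * z) ^+ 2); first by [].
rewrite /factor' /u; have h := pole_pt_neq i z1.
by field; rewrite h p0 -opprB oppr_eq0 h.
Qed.

Lemma poly_approx_finprod k : poly_approx (finprod k) (finprod' k).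
Proof.
elim: k => [|k IH].
  apply: poly_approx_ext (poly_approx_poly 1) => z _ /=; rewrite ?hornerE //.
    by rewrite /finprod big_ord0.
  by rewrite derivC horner0.
apply: poly_approx_ext (poly_approxM IH (poly_approx_factor k)) => z _ //.
by rewrite finprodS.
Qed.

(** No factor vanishes on the circle, so that the derivative is the product times
    its logarithmic derivative. *)
Lemma finprod'E k z : cmod z = 1 -> finprod' k z = finprod k z *
  \sum_(i < k) (zero_pt i - pole_pt i) / ((z - pole_pt i) * (z - zero_pt i)).
Proof.
move=> z1; elim: k => [|k IH] /=; first by rewrite big_ord0 mulr0.
rewrite big_ord_recr /= finprodS IH /factor /factor'.
have := pole_pt_neq k (cmod1_le z1); have := zero_pt_neq k z1 => h1 h2.
by field; rewrite h1 h2.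
Qed.

(** [small_or_far] says that at each point of the circle the product is at most
    the square of (a multiple of) the distance to all the zeros involved. *)
Variables C D : R.
Hypothesis C0 : 0 <= C.
Hypothesis D0 : 0 < D.
Hypothesis ab_sum : forall i, a i + b i <= C / i.+1%:R - C / i.+2%:R.
Hypothesis small_or_far : forall k z, cmod z = 1 -> exists d, [/\ 0 < d, d <= 1,
  cmod (finprod k z) <= d ^+ 2 & forall i, (i <= k)%N -> D * d <= cmod (z - zero_pt i)].

Lemma sum_ab_le k : \sum_(i < k) (a i + b i) <= C.
Proof.
apply: le_trans (_ : C - C / k.+1%:R <= _); last by rewrite gerBl divr_ge0.
elim: k => [|k IH]; first by rewrite big_ord0 divr1 subrr.
rewrite big_ord_recr /=; apply: le_trans (lerD IH (ab_sum k)) _.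
by rewrite addrA subrK.
Qed.

(** The logarithmic derivative grows at most like [d ^ -2] at distance [d] from
    the zeros, which is compensated by the smallness of the product. *)
Lemma cmod_finprod'_le k z : cmod z = 1 -> cmod (finprod' k z) <= C / D ^+ 2.
Proof.
move=> z1; have [d [d0 d1 fd far]] := small_or_far k z1.
rewrite finprod'E // cmodM.
have S : cmod (\sum_(i < k) (zero_pt i - pole_pt i) / ((z - pole_pt i) * (z - zero_pt i)))
       <= C / (D * d) ^+ 2.
  apply: le_trans (cmod_sum _ _ _) _.
  apply: le_trans (_ : \sum_(i < k) (a i + b i) / (D * d) ^+ 2 <= _).
    apply: ler_sum => i _; rewrite cmodM cmod_zero_sub_pole ler_wpM2l //.
      by rewrite addr_ge0 ?ltW.
    rewrite cmodV lef_pV2 ?posrE ?exprn_gt0 ?mulr_gt0 //; last first.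
      by rewrite cmod_gt0 mulf_neq0 ?zero_pt_neq ?pole_pt_neq ?z1.
    have fi := far i (ltnW (ltn_ord i)).
    rewrite cmodM expr2 ler_pM ?mulr_ge0 ?(ltW D0) ?(ltW d0) //.
    by apply: le_trans fi _; by apply: dist_zero_le_pole => //; exact: ltW.
  by rewrite -mulr_suml ler_wpM2r ?sum_ab_le // invr_ge0 sqr_ge0.
apply: le_trans (ler_pM (cmod_ge0 _) (cmod_ge0 _) fd S) _.
have -> : d ^+ 2 * (C / (D * d) ^+ 2) = C / D ^+ 2; last by [].
by field; rewrite !lt0r_neq0.
Qed.

Lemma finprod_step k z : cmod z = 1 ->
  cmod (finprod k.+1 z - finprod k z) <= (a k + b k) / D.
Proof.
move=> z1; have [d [d0 d1 fd far]] := small_or_far k z1.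
have zp := pole_pt_neq k (cmod1_le z1).
have -> : finprod k.+1 z - finprod k z =
          finprod k z * ((pole_pt k - zero_pt k) / (z - pole_pt k)).
  by rewrite finprodS /factor; field.
have S : cmod ((pole_pt k - zero_pt k) / (z - pole_pt k)) <= (a k + b k) / (D * d).
  rewrite cmodM cmodB cmod_zero_sub_pole ler_wpM2l //; first by rewrite addr_ge0 ?ltW.
  rewrite cmodV lef_pV2 ?posrE ?mulr_gt0 ?cmod_gt0 //.
  by apply: le_trans (far k (leqnn _)) _; by apply: dist_zero_le_pole => //; exact: ltW.
rewrite cmodM; apply: le_trans (ler_pM (cmod_ge0 _) (cmod_ge0 _) fd S) _.
have -> : d ^+ 2 * ((a k + b k) / (D * d)) = d * ((a k + b k) / D).
  by field; rewrite !lt0r_neq0.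
by rewrite ler_piMl // divr_ge0 ?(ltW D0) // addr_ge0 ?ltW.
Qed.

(** From [1 + a <= exp a] and [exp (- 2 b) <= 1 - b] for [b <= 1 / 2], each factor
    at [0] has modulus at least [exp (- 2 (a + b))]. *)
Lemma finprod0_ge k : expR (- (2 * C)) <= cmod (finprod k 0).
Proof.
apply: le_trans (_ : expR (- (2 * \sum_(i < k) (a i + b i))) <= _).
  by rewrite ler_expR lerN2 ler_wpM2l // sum_ab_le.
elim: k => [|k IH]; first by rewrite /finprod !big_ord0 mulr0 oppr0 expR0 cmod1.
rewrite big_ord_recr finprodS cmodM mulrDr opprD expRD.
rewrite ler_pM ?expR_ge0 //= /factor cmodM cmodV !sub0r !cmodN cmod_zero_pt cmod_pole_pt.
have bk := b0 k; have bk2 := b2 k; have ak := a0 k.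
have e1 : 1 + a k <= expR (a k) by exact: expR_ge1Dx.
have e2 : 1 + 2 * b k <= expR (2 * b k) by exact: expR_ge1Dx.
have -> : 2 * (a k + b k) = a k + (a k + 2 * b k) by ring.
rewrite ler_pdivlMr; last by lra.
rewrite expRN ler_pdivrMl ?expR_gt0 // !expRD.
have e3 : 1 <= expR (2 * b k) * (1 - b k).
  apply: le_trans (_ : (1 + 2 * b k) * (1 - b k) <= _); first by nra.
  by rewrite ler_wpM2r //; lra.
apply: (le_trans e1); rewrite -!mulrA ler_peMr ?expR_ge0 //.
by rewrite mulr_ege1 //; apply: le_trans e1; lra.
Qed.

(** The products are approximated by polynomials with errors comparable to the
    differences [1 / (k + 1) - 1 / (k + 2)], so that the approximants inherit the
    bounds on consecutive differences and on derivatives. *)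
Lemma exists_Dirichlet_vanishing : exists f : R[i] -> R[i],
  [/\ in_Dirichlet f, f 0 != 0 & forall i, f (zero_pt i) = 0].
Proof.
pose e k : R := k.+1%:R^-1 - k.+2%:R^-1.
have eE k : e k = (k.+1%:R * k.+2%:R)^-1.
  have x0 : 0 < k.+1%:R :> R by [].
  rewrite /e -[k.+2%:R]natr1; move: (k.+1%:R) x0 => x x0.
  by field; rewrite !lt0r_neq0 //; lra.
have e0 k : 0 < e k by rewrite eE invr_gt0 mulr_gt0.
have eS k : e k.+1 <= e k.
  rewrite !eE lef_pV2 ?posrE ?mulr_gt0 // mulrC ler_pM2l // ler_nat.
  exact: leq_trans (leqnSn _) (leqnSn _).
have e1 k : e k <= k.+1%:R^-1 by rewrite gerBl invr_ge0.
have /choice[p pP] : forall k, exists p : {poly R[i]}, forall z, cmod z <= 1 ->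
    cmod (p.[z] - finprod k z) <= e k /\ cmod (p^`().[z] - finprod' k z) <= e k.
  by move=> k; apply: poly_approx_finprod.
pose B := C / D + C / D ^+ 2 + 2.
have CD : 0 <= C / D by rewrite divr_ge0 // ltW.
have CD2 : 0 <= C / D ^+ 2 by rewrite divr_ge0 // sqr_ge0.
have B0 : 0 <= B by rewrite /B; lra.
have [| |f [fD fP]] := @Dirichlet_limit R p B B0.
- move=> k z z1; have [h1 _] := pP k z (cmod1_le z1).
  have [h2 _] := pP k.+1 z (cmod1_le z1).
  have h3 : cmod (finprod k.+1 z - finprod k z) <= C / D * e k.
    apply: le_trans (finprod_step k z1) _; rewrite mulrAC ler_wpM2r ?invr_ge0 ?(ltW D0) //.
    by rewrite /e mulrBr.
  have := cmodB_trans (finprod k.+1 z) (p k.+1).[z] (p k).[z].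
  have := cmodB_trans (finprod k z) (finprod k.+1 z) (p k).[z].
  rewrite [cmod (finprod k z - _)]cmodB -mulrBr -/(e k) /B.
  have := eS k; have := e0 k; have : 0 <= C / D ^+ 2 * e k by rewrite mulr_ge0 // ltW.
  lra.
- move=> k z z1; have [_ h1] := pP k z (cmod1_le z1).
  have := cmodB_trans (finprod' k z) (p k)^`().[z] 0; rewrite !subr0.
  have := cmod_finprod'_le k z1.
  have : e k <= 1 by apply: le_trans (e1 k) _; rewrite invf_le1 // ler1n.
  by rewrite /B; lra.
exists f; split=> // [|i]; last first.
  have q1 : cmod (zero_pt i) < 1 by rewrite cmod_zero_pt; have := b0 i; lra.
  apply/eqP; rewrite -cmod_eq0 eq_le cmod_ge0 andbT.
  apply: (@le_of_cvg0 _ _ _ (fun k => (1 + 2 * B / (1 - cmod (zero_pt i))) / k.+1%:R) i.+1);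
    last exact: cvg_inv_nat.
  move=> k ik; have [h1 _] := pP k _ (ltW q1).
  have := fP k _ q1; move: h1; rewrite finprod_zero_pt // subr0 => h1 h2.
  have := cmodB_trans (p k).[zero_pt i] (f (zero_pt i)) 0; rewrite !subr0 cmodB => h3.
  rewrite add0r mulrDl mul1r; apply: le_trans h3 _; rewrite addrC lerD ?(le_trans h1) //.
  by rewrite mulrAC.
apply/eqP => f0.
have : expR (- (2 * C)) <= 0; last by rewrite leNgt expR_gt0.
apply: (@le_of_cvg0 _ _ _ (fun k => (1 + 2 * B) / k.+1%:R) 0%N); last exact: cvg_inv_nat.
move=> k _; apply: le_trans (finprod0_ge k) _.
have c0 : cmod (0 : R[i]) = 0 by exact: cmod0.
have [|h1 _] := pP k 0; first by rewrite c0.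
have D00 : unit_disk (0 : R[i]) by change (cmod (0 : R[i]) < 1); rewrite c0.
have := fP k 0 D00; rewrite c0 f0 !subr0 divr1 => h2.
have := cmodB_trans (p k).[0] (finprod k 0) 0; rewrite !subr0 cmodB => h3.
rewrite add0r mulrDl mul1r; apply: le_trans h3 _; rewrite lerD ?(le_trans h1) //.
Qed.

End Product.

(** * A Cantor set on the circle *)

Section CantorParametrization.
Variable R : realType.
Implicit Types x y : R.

Definition rfloor x : R := (Num.floor x)%:~R.

Lemma rfloor_le x : rfloor x <= x.
Proof. exact: floor_le. Qed.

Lemma rfloor_gt x : x < rfloor x + 1.
Proof. by have := floorD1_gt x; rewrite rmorphD. Qed.

Lemma le_rfloor x y : x <= y -> rfloor x <= rfloor y.
Proof. by move=> xy; rewrite ler_int; exact: le_floor. Qed.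

Lemma rfloor_ge_int (n : int) x : n%:~R <= x -> n%:~R <= rfloor x.
Proof. by move=> nx; rewrite ler_int floor_ge_int. Qed.

Lemma rfloorD1_le x y : x + 1 <= y -> rfloor x + 1 <= rfloor y.
Proof.
move=> xy; have := @rfloor_ge_int (Num.floor x + 1) y.
by rewrite rmorphD /=; apply; have := rfloor_le x; rewrite /rfloor; lra.
Qed.

(** The [k]-th term jumps by [4 ^ -k / 16] at the dyadic numbers of level [k], so
    that the sum separates the dyadic intervals of each level [m] by gaps of order
    [4 ^ -m].  For [0 <= x < 1] the sum reads the doubled binary digits of [x] in
    base [4], but in this form monotonicity is visible on each term.  The factor
    [16] makes the image of the unit interval short. *)
Definition cantor_sum m x : R :=
  \sum_(0 <= k < m) rfloor (2 ^+ k * x) * 4^-1 ^+ k / 16.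

Let pow24 k : 2 ^+ k * 4^-1 ^+ k = 2^-1 ^+ k :> R.
Proof. by rewrite -exprMn; congr (_ ^+ _); field. Qed.

(** The terms are [O((|x| + 1) 2 ^ -k)], so that the series converges on the whole
    line. *)
Lemma cantor_limit_exists : exists G : R -> R, forall x m,
  `|cantor_sum m x - G x| <= (`|x| + 1) * 2^-1 ^+ m.
Proof.
suff : forall x, exists g, forall m, `|cantor_sum m x - g| <= (`|x| + 1) * 2^-1 ^+ m.
  by move/choice => [G GP]; exists G.
move=> x; apply: real_cauchy_limit => k l.
have e0 n : 0 <= (`|x| + 1) * 2^-1 ^+ n by rewrite mulr_ge0 ?addr_ge0 ?exprn_ge0.
wlog kl : k l / (k <= l)%N.
  by move=> W; have [/W //|/ltnW/W] := leqP k l; rewrite distrC [leRHS]addrC.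
rewrite distrC /cantor_sum (big_cat_nat (n := k)) //= addrAC subrr add0r.
apply: le_trans (ler_norm_sum _ _ _) _.
apply: le_trans (_ : (`|x| + 1) / 16 * \sum_(k <= i < l) 2^-1 ^+ i <= _).
  rewrite mulr_sumr; apply: ler_sum => i _.
  have p0 : 0 < 2 ^+ i :> R by rewrite exprn_gt0.
  have p1 : 1 <= 2 ^+ i :> R by rewrite exprn_ege1 // ler1n.
  have q0 : 0 <= 4^-1 ^+ i :> R by rewrite exprn_ge0.
  have bf : `|rfloor (2 ^+ i * x)| <= 2 ^+ i * (`|x| + 1).
    have := rfloor_le (2 ^+ i * x); have := rfloor_gt (2 ^+ i * x).
    rewrite ler_norml => h1 h2; have h3 := ler_norm x; have h4 := ler_norm (- x).
    rewrite normrN in h4; apply/andP; split; nra.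
  rewrite !normrM [`|4^-1 ^+ i|]ger0_norm // [`|16^-1|]ger0_norm ?invr_ge0 //.
  by rewrite -pow24 [leRHS]mulrAC ler_pM2r ?invr_gt0 // mulrA ler_wpM2r // [leRHS]mulrC.
have h1 : 2^-1 < 1 :> R by lra.
have := @sum_geom_le R 2^-1 k l _ h1; rewrite invr_ge0 ler0n => /(_ isT) S.
apply: le_trans (_ : (`|x| + 1) * 2^-1 ^+ k <= _); last by rewrite lerDl.
rewrite -mulrA ler_wpM2l ?addr_ge0 //.
have : 0 <= 2^-1 ^+ k :> R by rewrite exprn_ge0.
have e : (1 - 2^-1)^-1 = 2 :> R by field; lra.
by move: S; rewrite e; set s := \sum_(_ <= _ < _) _; set t := _ ^+ k; lra.
Qed.

Lemma le_cantor_sum m x y : x <= y -> cantor_sum m x <= cantor_sum m y.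
Proof.
move=> xy; apply: ler_sum => k _; rewrite !ler_wpM2r ?invr_ge0 ?exprn_ge0 //.
by apply: le_rfloor; rewrite ler_wpM2l // exprn_ge0.
Qed.

(** The [i]-th term increases by at least one jump when [2 ^ i (y - x) >= 1], and
    the other terms do not decrease. *)
Lemma cantor_sum_gap m i x y : (i < m)%N -> x <= y -> 1 <= 2 ^+ i * (y - x) ->
  cantor_sum m x <= cantor_sum m y - 4^-1 ^+ i / 16.
Proof.
move=> im xy gap; rewrite /cantor_sum.
have t k : rfloor (2 ^+ k * x) * 4^-1 ^+ k / 16 <= rfloor (2 ^+ k * y) * 4^-1 ^+ k / 16.
  rewrite !ler_wpM2r ?invr_ge0 ?exprn_ge0 //.
  by apply: le_rfloor; rewrite ler_wpM2l // exprn_ge0.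
have s a b : \sum_(a <= k < b) rfloor (2 ^+ k * x) * 4^-1 ^+ k / 16 <=
             \sum_(a <= k < b) rfloor (2 ^+ k * y) * 4^-1 ^+ k / 16.
  by apply: ler_sum.
have q0 : 0 <= 4^-1 ^+ i :> R by rewrite exprn_ge0.
have u : rfloor (2 ^+ i * x) * 4^-1 ^+ i / 16 + 4^-1 ^+ i / 16
         <= rfloor (2 ^+ i * y) * 4^-1 ^+ i / 16.
  rewrite -mulrDl -[X in _ + X]mul1r -mulrDl ler_wpM2r ?invr_ge0 //.
  by rewrite ler_wpM2r // rfloorD1_le //; move: gap; rewrite mulrBr; lra.
rewrite ![\sum_(0 <= _ < m) _](big_cat_nat (n := i)) ?(ltnW im) //=.
rewrite ![\sum_(i <= _ < m) _]big_ltn //.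
have := s 0%N i; have := s i.+1 m; move: u.
set a1 := \sum_(_ <= _ < i) _; set a2 := \sum_(_ <= _ < m) _.
set a3 := \sum_(_ <= _ < i) _; set a4 := \sum_(_ <= _ < m) _.
lra.
Qed.

(** The integer part of [2 ^ m x] determines that of [2 ^ k x] for [k <= m]. *)
Lemma rfloor_pow2_eq k m x y : (k <= m)%N -> rfloor (2 ^+ m * x) = rfloor (2 ^+ m * y) ->
  rfloor (2 ^+ k * y) <= rfloor (2 ^+ k * x).
Proof.
move=> km e; apply: rfloor_ge_int; set Y := Num.floor _.
have p0 : 0 < 2 ^+ (m - k) :> R by rewrite exprn_gt0.
have E z : 2 ^+ (m - k) * (2 ^+ k * z) = 2 ^+ m * z :> R by rewrite mulrA -exprD subnK.
have h : ((2 ^+ (m - k) * Y)%:~R <= 2 ^+ m * y :> R).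
  by rewrite rmorphM rmorphXn /= -E ler_pM2l //; exact: rfloor_le.
have := rfloor_ge_int h; rewrite -e => h2.
have := le_trans h2 (rfloor_le _); rewrite rmorphM rmorphXn /= -E.
by rewrite ler_pM2l.
Qed.

(** The terms up to [m] agree; beyond [m] the integer parts differ by at most
    [2 ^ (k - m)], which leaves a geometric tail. *)
Lemma cantor_sum_near m n x y : rfloor (2 ^+ m * x) = rfloor (2 ^+ m * y) ->
  cantor_sum n y <= cantor_sum n x + 4^-1 ^+ m / 16.
Proof.
move=> e.
have small k : rfloor (2 ^+ k * y) * 4^-1 ^+ k / 16 <=
    rfloor (2 ^+ k * x) * 4^-1 ^+ k / 16 +
    (if (k <= m)%N then 0 else 4^-1 ^+ m / 16 * 2^-1 ^+ (k - m)).
  have q0 : 0 <= 4^-1 ^+ k :> R by rewrite exprn_ge0.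
  case: leqP => km.
    by rewrite addr0 !ler_wpM2r ?invr_ge0 //; exact: rfloor_pow2_eq e.
  have -> : 4^-1 ^+ m / 16 * 2^-1 ^+ (k - m) = 2 ^+ (k - m) * 4^-1 ^+ k / 16 :> R.
    rewrite -{3}(subnKC (ltnW km)) exprD -(pow24 (k - m)).
    by ring.
  rewrite -!mulrDl !ler_wpM2r ?invr_ge0 //.
  have E z : 2 ^+ (k - m) * (2 ^+ m * z) = 2 ^+ k * z :> R.
    by rewrite mulrA -exprD subnK // ltnW.
  have p0 : 0 < 2 ^+ (k - m) :> R by rewrite exprn_gt0.
  have h1 : 2 ^+ (k - m) * rfloor (2 ^+ m * x) <= rfloor (2 ^+ k * x).
    have := @rfloor_ge_int (2 ^+ (k - m) * Num.floor (2 ^+ m * x)) (2 ^+ k * x).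
    rewrite rmorphM rmorphXn /=; apply.
    by rewrite -E ler_pM2l //; exact: rfloor_le.
  have h2 : rfloor (2 ^+ k * y) <= 2 ^+ (k - m) * (rfloor (2 ^+ m * x) + 1).
    apply: le_trans (rfloor_le _) _; rewrite -E ler_pM2l //.
    by rewrite e ltW // rfloor_gt.
  by move: h1 h2; rewrite mulrDr mulr1; lra.
apply: le_trans (ler_sum _ (fun k _ => small k)) _.
rewrite big_split /= lerD2l.
have tail0 : 0 <= 4^-1 ^+ m / 16 :> R by rewrite divr_ge0 // exprn_ge0.
(* The truncated subtraction [n.-1 - m] makes the formula valid for [n <= m] too. *)
suff -> : \sum_(0 <= k < n) (if (k <= m)%N then 0 else 4^-1 ^+ m / 16 * 2^-1 ^+ (k - m))
    = 4^-1 ^+ m / 16 * (1 - 2^-1 ^+ (n.-1 - m)) :> R.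
  by rewrite ler_piMr // gerBl exprn_ge0.
elim: n => [|n IH]; first by rewrite big_geq // sub0n expr0 subrr mulr0.
rewrite big_nat_recr //= {}IH; case: leqP => nm.
  have -> : (n - m)%N = 0%N by apply/eqP; rewrite subn_eq0.
  have -> : (n.-1 - m)%N = 0%N by apply/eqP; rewrite subn_eq0 (leq_trans (leq_pred _)).
  by rewrite addr0.
case: n nm => // n nm; rewrite subSn // exprS /=.
by field.
Qed.

Variable G : R -> R.
Hypothesis GP : forall x m, `|cantor_sum m x - G x| <= (`|x| + 1) * 2^-1 ^+ m.

Lemma cantor_limit_le x y d N :
  (forall m, (N <= m)%N -> cantor_sum m x <= cantor_sum m y + d) -> G x <= G y + d.
Proof.
move=> h; apply: (@le_of_cvg0 _ _ _ (fun m => (`|x| + `|y| + 2) * 2^-1 ^+ m) N) => [m Nm|].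
  have := h m Nm; have := GP x m; have := GP y m.
  rewrite !ler_norml !mulrDl mul1r => /andP[_ h1] /andP[h2 _].
  by move: h1 h2; set u := _ ^+ m; lra.
by apply: cvg_geom0; rewrite ?invr_ge0 //; lra.
Qed.

Lemma le_cantor_limit x y : x <= y -> G x <= G y.
Proof.
move=> xy; rewrite -[G y]addr0; apply: (@cantor_limit_le _ _ _ 0%N) => m _.
by rewrite addr0 le_cantor_sum.
Qed.

Lemma cantor_limit_near m x y : rfloor (2 ^+ m * x) = rfloor (2 ^+ m * y) ->
  `|G x - G y| <= 4^-1 ^+ m / 16.
Proof.
move=> e; rewrite ler_norml; apply/andP; split.
  rewrite lerBrDr addrC lerBlDr.
  by apply: (@cantor_limit_le _ _ _ 0%N) => n _; exact: cantor_sum_near.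
rewrite lerBlDl.
by apply: (@cantor_limit_le _ _ _ 0%N) => n _; exact: cantor_sum_near.
Qed.

Lemma dyadic_scale (d : R) : 0 < d -> d <= 1 ->
  exists i, 1 <= 2 ^+ i * d /\ 2 ^+ i * d <= 2.
Proof.
move=> d0 d1.
have ex : exists i, 1 <= 2 ^+ i * d.
  exists (Num.bound d^-1); rewrite -ler_pdivrMr // mul1r.
  have := archi_boundP (ltW d0 : 0 <= d); have h0 : 0 <= d^-1 by rewrite invr_ge0 ltW.
  move=> _; apply: le_trans (ltW (archi_boundP h0)) _.
  by rewrite -natrX ler_nat ltnW // ltn_expl.
case: (ex_minnP ex) => -[|i] i1 imin; first by exists 0%N; split=> //; rewrite expr0; lra.
exists i.+1; split=> //; rewrite exprS -mulrA.
have : ~~ (1 <= 2 ^+ i * d) by apply/negP => /imin; rewrite ltnn.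
by rewrite -ltNge; lra.
Qed.

(** At the scale [i] with [1 <= 2 ^ i (y - x) <= 2] the gap is [4 ^ -i / 16], which
    is comparable with [(y - x) ^ 2].  This is what gives the image of Lebesgue
    measure finite logarithmic energy. *)
Lemma cantor_limit_expand x y : `|x - y| <= 1 -> (x - y) ^+ 2 / 64 <= `|G x - G y|.
Proof.
wlog xy : x y / x <= y.
  move=> W; have [/W //|/ltW/W] := leP x y.
  by rewrite distrC -sqrrN opprB [`|G y - _|]distrC.
move=> d1; rewrite [leRHS]distrC ger0_norm ?subr_ge0 ?le_cantor_limit //.
move: d1; rewrite distrC ger0_norm ?subr_ge0 // -sqrrN opprB => d1.
have [->|ne] := eqVneq x y; first by rewrite !subrr expr0n mul0r.
have d0 : 0 < y - x by rewrite subr_gt0 lt_neqAle ne.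
have [i [i1 i2]] := dyadic_scale d0 d1.
have : G x <= G y + (- (4^-1 ^+ i / 16)).
  apply: (@cantor_limit_le _ _ _ i.+1) => m im.
  exact: cantor_sum_gap im xy i1.
have : (y - x) ^+ 2 <= 4 * 4^-1 ^+ i.
  have p0 : 0 < 2 ^+ i :> R by rewrite exprn_gt0.
  have -> : 4^-1 ^+ i = (2 ^+ i) ^- 2 :> R.
    by rewrite exprVn exprAC; congr (_ ^+ _)^-1; ring.
  rewrite -ler_pdivrMr ?invr_gt0 ?exprn_gt0 // invrK.
  by rewrite mulrC -exprMn; nra.
by set q := 4^-1 ^+ i; lra.
Qed.

Lemma cantor_limit_range x : 0 <= x -> x <= 1 -> 0 <= G x <= 1 / 8.
Proof.
move=> x0 x1; apply/andP; split.
  apply: (@le_of_cvg0 _ _ _ (fun m => (`|x| + 1) * 2^-1 ^+ m) 0%N) => [m _|]; last first.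
    by apply: cvg_geom0; rewrite ?invr_ge0 //; lra.
  have := GP x m; rewrite ler_norml => /andP[_].
  have : 0 <= cantor_sum m x; last by lra.
  apply: sumr_ge0 => k _; rewrite !mulr_ge0 ?invr_ge0 ?exprn_ge0 //.
  have := @rfloor_ge_int 0 (2 ^+ k * x); rewrite /= mulr0z; apply.
  by rewrite mulr_ge0 ?exprn_ge0.
apply: (@le_of_cvg0 _ _ _ (fun m => (`|x| + 1) * 2^-1 ^+ m) 0%N) => [m _|]; last first.
  by apply: cvg_geom0; rewrite ?invr_ge0 //; lra.
have := GP x m; rewrite ler_norml => /andP[+ _].
have : cantor_sum m x <= 1 / 8; last by lra.
apply: le_trans (_ : 16^-1 * \sum_(0 <= k < m) 2^-1 ^+ k <= _).
  rewrite mulr_sumr; apply: ler_sum => k _.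
  rewrite mulrC ler_pM2l ?invr_gt0 // -pow24 ler_wpM2r ?exprn_ge0 ?invr_ge0 //.
  by apply: le_trans (rfloor_le _) _; rewrite ler_piMr // exprn_ge0.
have h0 : 0 <= 2^-1 :> R by rewrite invr_ge0.
have h1 : 2^-1 < 1 :> R by lra.
have e : (1 - 2^-1)^-1 = 2 :> R by field; lra.
have := sum_geom_le 0 m h0 h1; rewrite expr0 mul1r e.
by set s := \sum_(_ <= _ < _) _; lra.
Qed.

End CantorParametrization.

Section Cayley.
Variable R : realType.
Implicit Types s t : R.

(** A chart of the circle that is algebraic, and bi-Lipschitz on [|t| <= 1]. *)
Definition cayley t : R[i] := (1 +i* t) / (1 -i* t).

Let den_neq0 t : 1 -i* t != 0 :> R[i].
Proof. by rewrite eq_complex /= oner_eq0. Qed.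

Lemma cmod_cayley t : cmod (cayley t) = 1.
Proof.
rewrite cmodM cmodV; have -> : cmod (1 -i* t) = cmod (1 +i* t) by rewrite /= sqrrN.
rewrite mulfV // cmod_eq0.
by rewrite eq_complex /= oner_eq0.
Qed.

Lemma cayleyB s t : cayley s - cayley t = 2 * (0 +i* (s - t)) / ((1 -i* s) * (1 -i* t)).
Proof.
have -> : 0 +i* (s - t) = (1 -i* t) - (1 -i* s).
  by apply/eqP; rewrite eq_complex /= subrr opprK addrC !eqxx.
have E u : 1 +i* u = 1 + 1 - (1 -i* u) :> R[i].
  by apply/eqP; rewrite eq_complex /= addrK !opprK !add0r !eqxx.
rewrite /cayley (E s) (E t).
move: (1 -i* s) (1 -i* t) (den_neq0 s) (den_neq0 t) => u v u0 v0.
by field; rewrite u0 v0.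
Qed.

Let cmod_den t : cmod (1 -i* t) ^+ 2 = 1 + t ^+ 2.
Proof. by rewrite sqr_cmod /= sqrrN expr1n. Qed.

Let cmod_cayleyB s t : cmod (cayley s - cayley t) =
  2 * `|s - t| / (cmod (1 -i* s) * cmod (1 -i* t)).
Proof.
rewrite cayleyB !cmodM cmodV cmodM -(rmorph_nat (real_complex R)) cmod_real normr_nat.
by congr (_ * _ / _); rewrite /= expr0n add0r sqrtr_sqr.
Qed.

Let den_ge1 t : 1 <= cmod (1 -i* t).
Proof. by rewrite -ler_sqr ?nnegrE ?cmod_ge0 // cmod_den expr1n lerDl sqr_ge0. Qed.

Lemma cayley_lipschitz s t : cmod (cayley s - cayley t) <= 2 * `|s - t|.
Proof.
rewrite cmod_cayleyB ler_pdivrMr ?ler_peMr ?mulr_ge0 ?mulr_ege1 ?den_ge1 //.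
by rewrite mulr_gt0 //; exact: lt_le_trans ltr01 (den_ge1 _).
Qed.

Lemma cayley_expand s t : `|s| <= 1 -> `|t| <= 1 -> `|s - t| <= cmod (cayley s - cayley t).
Proof.
move=> s1 t1; have p (u : R) : 0 < cmod (1 -i* u) by exact: lt_le_trans ltr01 (den_ge1 u).
rewrite cmod_cayleyB ler_pdivlMr ?mulr_gt0 // mulrC ler_wpM2r //.
have b (u : R) : `|u| <= 1 -> cmod (1 -i* u) ^+ 2 <= 2.
  by move=> u1; rewrite cmod_den -real_normK ?num_real //; have := normr_ge0 u; nra.
have := b s s1; have := b t t1; have := p s; have := p t; nra.
Qed.

End Cayley.

(** * The zeros *)

Section Points.
Variables (R : realType) (G : R -> R).
Hypothesis GP : forall x m, `|cantor_sum m x - G x| <= (`|x| + 1) * 2^-1 ^+ m.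

(** Writing [i + 1 = 2 ^ m + j] with [j < 2 ^ m] enumerates the pairs of a level [m]
    and a dyadic number [j / 2 ^ m]. *)
Definition level i := trunc_log 2 i.+1.
Definition dyadic i : R := (i.+1 - 2 ^ level i)%:R / 2 ^+ level i.
Definition anchor i : R[i] := cayley (G (dyadic i)).
(** Of order [4 ^ - level i], and strictly decreasing in [i], so that the zeros are
    distinct although their anchors are not. *)
Definition depth i : R := 1 / (2 * i.+1%:R ^+ 2).
(** The ratio to the depth has to be large enough for the factors to be at most
    [1/16] near their anchors. *)
Definition height i : R := 256 / i.+1%:R ^+ 2.
Definition cantor_zero : nat -> R[i] := zero_pt anchor depth.

Lemma level_bounds i : (2 ^ level i <= i.+1 < 2 ^ (level i).+1)%N.
Proof. exact: trunc_log_bounds. Qed.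

Lemma dyadic_itv i : 0 <= dyadic i < 1.
Proof.
have /andP[h1 h2] := level_bounds i.
have p0 : 0 < 2 ^+ level i :> R by rewrite exprn_gt0.
rewrite divr_ge0 ?(ltW p0) //= ltr_pdivrMr // mul1r -natrX ltr_nat.
by rewrite ltn_subLR // addnn -mul2n -expnS.
Qed.

(** The anchor is the one given by the first [m] binary digits of [x]. *)
Lemma dyadic_dense x m : 0 <= x -> x < 1 ->
  exists2 i, level i = m & `|G x - G (dyadic i)| <= 4^-1 ^+ m / 16.
Proof.
move=> x0 x1; have p0 : 0 < 2 ^+ m :> R by rewrite exprn_gt0.
have f0 : 0 <= Num.floor (2 ^+ m * x) by rewrite floor_ge0 mulr_ge0 // ltW.
have f1 : Num.floor (2 ^+ m * x) < (2 ^ m)%N.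
  by rewrite floor_lt_int -pmulrn natrX gtr_pMr.
case E : (Num.floor (2 ^+ m * x)) f0 f1 => [j|//] _ j2.
have j2' : (j < 2 ^ m)%N by exact: j2.
have i1 : (2 ^ m + j).-1.+1 = (2 ^ m + j)%N by rewrite prednK // addn_gt0 expn_gt0.
have lm : level (2 ^ m + j).-1 = m.
  rewrite /level i1; apply: trunc_log_eq => //.
  by rewrite leq_addr expnS mul2n -addnn ltn_add2l.
exists (2 ^ m + j).-1 => //; apply: cantor_limit_near => //.
rewrite /dyadic lm i1 addKn mulrCA divff ?lt0r_neq0 // mulr1 /rfloor E.
by rewrite -[j%:R]/(j%:~R) intrKfloor.
Qed.

Lemma cmod_anchor i : cmod (anchor i) = 1.
Proof. exact: cmod_cayley. Qed.

Lemma dist_anchor_le i j : cmod (anchor i - anchor j) <= 1 / 4.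
Proof.
apply: le_trans (cayley_lipschitz _ _) _.
have b k : 0 <= G (dyadic k) <= 1 / 8.
  by have /andP[h1 /ltW h2] := dyadic_itv k; apply: cantor_limit_range.
have /andP[i1 i2] := b i; have /andP[j1 j2] := b j.
have : `|G (dyadic i) - G (dyadic j)| <= 1 / 8; last by lra.
by rewrite ler_norml; apply/andP; split; lra.
Qed.

Lemma depth_gt0 i : 0 < depth i.
Proof. by rewrite divr_gt0 // mulr_gt0 // exprn_gt0. Qed.

Lemma depth_le_half i : depth i <= 1 / 2.
Proof.
rewrite /depth ler_pdivrMr ?mulr_gt0 ?exprn_gt0 //.
have : 1 <= i.+1%:R ^+ 2 :> R by rewrite exprn_ege1 // ler1n.
by move: (_ ^+ 2) => t; lra.
Qed.

Lemma depth_le_height i : depth i <= height i.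
Proof.
have p : 0 < i.+1%:R ^+ 2 :> R by rewrite exprn_gt0.
by rewrite /depth /height invfM mulrA ler_pM2r ?invr_gt0 //; lra.
Qed.

Lemma depth_height_sum i : height i + depth i <= 514 / i.+1%:R - 514 / i.+2%:R.
Proof.
rewrite /height /depth -[i.+2%:R]natr1.
have x1 : 1 <= i.+1%:R :> R by rewrite ler1n.
move: (i.+1%:R) x1 => x x1; have x0 : 0 < x by lra.
have -> : 256 / x ^+ 2 + 1 / (2 * x ^+ 2) = (256 + 1 / 2) / x ^+ 2.
  by field; rewrite lt0r_neq0.
have -> : 514 / x - 514 / (x + 1) = 514 / (x * (x + 1)).
  by field; rewrite !lt0r_neq0 //; lra.
rewrite ler_pdivrMr ?exprn_gt0 // mulrAC ler_pdivlMr ?mulr_gt0 //; last by lra.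
by nra.
Qed.

Let q4 m : 4^-1 ^+ m = (2 ^+ m) ^- 2 :> R.
Proof. by rewrite exprVn exprAC; congr (_ ^+ _)^-1; ring. Qed.

Lemma depth_level i : 4^-1 ^+ level i / 8 <= depth i <= 4^-1 ^+ level i / 2.
Proof.
have /andP[h1 h2] := level_bounds i.
have p0 : 0 < 2 ^+ level i :> R by rewrite exprn_gt0.
have h1' : 2 ^+ level i <= i.+1%:R :> R by rewrite -natrX ler_nat.
have h2' : i.+1%:R <= 2 * 2 ^+ level i :> R by rewrite -exprS -natrX ler_nat ltnW.
rewrite q4 /depth; move: (2 ^+ _) (i.+1%:R) p0 h1' h2' => u v u0 uv vu.
have v0 : 0 < v by exact: lt_le_trans uv.
have -> : u ^- 2 / 8 = (8 * u ^+ 2)^-1 by field; rewrite lt0r_neq0.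
have -> : u ^- 2 / 2 = (2 * u ^+ 2)^-1 by field; rewrite lt0r_neq0.
by rewrite div1r !lef_pV2 ?posrE ?mulr_gt0 ?exprn_gt0 //; apply/andP; split; nra.
Qed.

Lemma height_level i : height i = 512 * depth i.
Proof.
have : i.+1%:R != 0 :> R by rewrite pnatr_eq0.
by rewrite /height /depth; move: (i.+1%:R) => x x0; field.
Qed.

(** Near its anchor the factor is about [(depth + distance) / height]. *)
Lemma factor_small i z : cmod z = 1 ->
  cmod (z - anchor i) <= 2 * 4^-1 ^+ level i ->
  cmod (factor anchor height depth i z) <= 16^-1.
Proof.
move=> z1 zi; have hd := depth_level i; have hl := height_level i.
have h0 : 0 < height i := lt_le_trans (depth_gt0 i) (depth_le_height i).
have zp : cmod (z - pole_pt anchor height i) >= height i.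
  by apply: dist_pole_ge_depth; rewrite ?cmod_anchor // ltW.
have zq : cmod (z - zero_pt anchor depth i) ^+ 2 <= depth i ^+ 2 + cmod (z - anchor i) ^+ 2.
  by apply: sqr_dist_zero_le; rewrite ?cmod_anchor // ltW // depth_gt0.
rewrite cmodM cmodV ler_pdivrMr; last exact: lt_le_trans zp.
apply: le_trans (_ : height i / 16 <= _); last by rewrite [leRHS]mulrC ler_wpM2r // invr_ge0.
rewrite -ler_sqr ?nnegrE ?cmod_ge0 ?divr_ge0 ?(ltW h0) //.
apply: le_trans zq _; rewrite hl; move: hd zi (depth_gt0 i) (cmod_ge0 (z - anchor i)).
move: (depth i) (cmod _) (4^-1 ^+ _) => d c q /andP[h1 h2] h3 h4 h5; nra.
Qed.

Lemma prod_le_one_term (F : nat -> R) m n i th : (forall i, 0 <= F i <= 1) ->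
  (m <= i < n)%N -> F i <= th -> \prod_(m <= j < n) F j <= th.
Proof.
move=> F01 /andP[mi iN] Fi.
have pr a b : 0 <= \prod_(a <= j < b) F j <= 1.
  by apply/andP; split; [apply: prodr_ge0 => j _; case/andP: (F01 j)|apply: prodr_ile1].
rewrite (big_cat_nat (n := i)) ?(ltnW iN) //= [\prod_(i <= _ < n) _]big_ltn //.
have /andP[a0 a1] := pr m i; have /andP[c0 c1] := pr i.+1 n; have /andP[f0 _] := F01 i.
apply: (le_trans _ Fi); rewrite mulrCA ler_piMr // mulr_ile1 //.
Qed.

(** Let [d = 4 ^ -n] be the scale of the distance from [z] to the anchors, or of the
    least depth involved if that is larger.  The levels below [n] contribute one
    small factor each, hence [16 ^ -n = d ^ 2]. *)
Lemma small_or_far k z : cmod z = 1 -> exists d, [/\ 0 < d, d <= 1,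
  cmod (finprod anchor height depth k z) <= d ^+ 2 &
  forall i, (i <= k)%N -> 1 / 8 * d <= cmod (z - cantor_zero i)].
Proof.
move=> z1; pose P n := (2 ^ n <= k.+1)%N /\
  exists2 i, (i <= k)%N & cmod (z - anchor i) <= 4 * 4^-1 ^+ n.
(* [P n]: the levels below [n] are all present among the first [k] factors, and
   some anchor is within [O(4 ^ -n)] of [z].  Take the last [n] such that [P]
   holds up to [n]. *)
have [n [nP Pn]] : exists n, ~ P n.+1 /\ (n = 0%N \/ P n).
  have [n0 Pn0] : exists n, ~ P n by exists k.+1 => -[+ _]; rewrite leqNgt ltn_expl.
  have ex : exists n, `[< ~ P n.+1 >].
    exists n0; apply/asboolP => -[h [i ik hi]].
    apply: Pn0; split.
      by apply: leq_trans h; rewrite leq_exp2l.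
    exists i => //; apply: le_trans hi _; rewrite ler_wpM2l // exprS ler_piMl ?exprn_ge0 //.
    by rewrite invf_le1 // ler1n.
  case: (ex_minnP ex) => n /asboolP Pn nmin; exists n; split=> //.
  case: n {Pn} nmin => [|n] nmin; first by left.
  right; apply: contrapT => h; have := nmin n; rewrite ltnn => H.
  by apply: notF; apply: H; apply/asboolP.
pose q : R := 4^-1 ^+ n.
have q0 : 0 < q by rewrite exprn_gt0 // invr_gt0.
have q1 : q <= 1 by rewrite exprn_ile1 // ?invr_ge0 // invf_le1 // ler1n.
have d0 i : cmod (z - cantor_zero i) >= depth i.
  by apply: dist_zero_ge_depth; rewrite ?cmod_anchor ?depth_le_half // ltW // depth_gt0.
have far i : cmod (z - anchor i) / 2 <= cmod (z - cantor_zero i).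
  by apply: dist_zero_ge_half; rewrite ?cmod_anchor ?depth_le_half.
exists q; split=> // [|i ik]; last first.
  have [kn|kn] := leqP (2 ^ n.+1)%N k.+1.
    have : 4 * 4^-1 ^+ n.+1 < cmod (z - anchor i).
      by rewrite ltNge; apply/negP => h; apply: nP; split=> //; exists i.
    by have := far i; rewrite exprS mulrA divff // mul1r -/q; lra.
  apply: le_trans (d0 i); have /andP[h _] := depth_level i; apply: le_trans h.
  rewrite mulrC mul1r ler_pM2r ?invr_gt0 //.
  apply: ler_wiXn2l; rewrite ?invr_ge0 ?invf_le1 ?ler1n //.
  have /andP[h _] := level_bounds i.
  rewrite -ltnS -(ltn_exp2l _ _ (ltnSn 1)); apply: leq_ltn_trans h _.
  exact: leq_ltn_trans kn.
pose F i := cmod (factor anchor height depth i z).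
have F01 i : 0 <= F i <= 1.
  rewrite cmod_ge0 /F cmod_factor_le1 // => j;
    by rewrite ?cmod_anchor ?depth_gt0 ?depth_le_half ?depth_le_height.
have -> : cmod (finprod anchor height depth k z) = \prod_(0 <= i < k) F i.
  by rewrite cmod_prod big_mkord.
case: Pn => [n0|[nk [i0 i0k zi0]]].
  rewrite /q n0 expr0 expr1n.
  exact: prodr_ile1.
have lev m : (m <= n)%N -> \prod_(0 <= i < (2 ^ m).-1) F i <= 16^-1 ^+ m.
  elim: m => [_|m IH mn]; first by rewrite big_geq // expr0.
  have le1 : ((2 ^ m).-1 <= (2 ^ m.+1).-1)%N by rewrite -!subn1 leq_sub2r // leq_exp2l.
  rewrite (big_cat_nat (n := (2 ^ m).-1)) //= exprSr.
  have /andP[x0 x1] := dyadic_itv i0.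
  have [i lm near] := @dyadic_dense _ m x0 x1.
  have /andP[b1 b2] := level_bounds i; rewrite lm in b1 b2.
  apply: ler_pM; rewrite ?prodr_ge0 //.
  - by move=> j _; case/andP: (F01 j).
  - by move=> j _; case/andP: (F01 j).
  - exact: IH (ltnW mn).
  apply: (@prod_le_one_term F _ _ i) => //.
    by rewrite -ltnS prednK ?expn_gt0 // b1 /= -ltnS prednK ?expn_gt0.
  apply: factor_small => //; rewrite lm.
  have h := cayley_lipschitz (G (dyadic i0)) (G (dyadic i)).
  apply: le_trans (cmodB_trans (anchor i0) _ _) _.
  have : 4 * 4^-1 ^+ n <= 4^-1 ^+ m :> R.
    have -> : 4^-1 ^+ m = 4 * 4^-1 ^+ m.+1 :> R by rewrite exprS mulrA divff // mul1r.
    by rewrite ler_pM2l // ler_wiXn2l ?invr_ge0 ?invf_le1 ?ler1n.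
  have : 0 <= 4^-1 ^+ m :> R by rewrite exprn_ge0 // invr_ge0.
  move: near h zi0; rewrite -/(anchor i0) -/(anchor i).
  move: (4^-1 ^+ n) (4^-1 ^+ m) `|_| (cmod _) (cmod _) => u v d c1 c2; lra.
have nk' : ((2 ^ n).-1 <= k)%N by rewrite -ltnS prednK ?expn_gt0.
rewrite (big_cat_nat (n := (2 ^ n).-1)) //=.
have -> : q ^+ 2 = 16^-1 ^+ n * 1.
  by rewrite mulr1 /q exprAC; congr (_ ^+ _); field.
apply: ler_pM; rewrite ?prodr_ge0 ?lev //.
- by move=> j _; case/andP: (F01 j).
- by move=> j _; case/andP: (F01 j).
- exact: prodr_ile1.
Qed.

Lemma zero_set_cantor_zero : zero_set_Dirichlet cantor_zero.
Proof.
have a1 := cmod_anchor; have b0 := depth_gt0; have b2 := depth_le_half.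
have ba := depth_le_height.
have D0 : 0 < 1 / 8 :> R by lra.
have [f [fD f0 fZ]] := exists_Dirichlet_vanishing a1 b0 b2 ba (ler0n R 514) D0
  depth_height_sum small_or_far.
have cZ i : cmod (cantor_zero i) = 1 - depth i by exact: cmod_zero_pt.
split=> [i j ij|i|].
- have : cmod (cantor_zero i) = cmod (cantor_zero j) by rewrite ij.
  rewrite !cZ => /(@addrI _ _ _ _)/oppr_inj.
  rewrite /depth !div1r => /invr_inj/(mulfI _) e.
  have {e} : i.+1%:R ^+ 2 = j.+1%:R ^+ 2 :> R by apply: e; rewrite pnatr_eq0.
  by move=> /eqP; rewrite eqrXn2 // eqr_nat => /eqP[].
- by change (cmod (cantor_zero i) < 1); rewrite cZ; have := b0 i; lra.
- exists f; split=> //; exists 0 => //.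
  by change (cmod (0 : R[i]) < 1); rewrite cmod0.
Qed.

End Points.

(** * The exceptional set *)

Section ExceptionalSet.
Variables (R : realType) (G : R -> R).
Hypothesis GP : forall x m, `|cantor_sum m x - G x| <= (`|x| + 1) * 2^-1 ^+ m.

Local Notation Z := (cantor_zero G).
Local Notation anchor := (anchor G).
Let poisson (zeta : R[i]) n := (1 - cmod (Z n) ^+ 2) / cmod (zeta - Z n) ^+ 2.

Let cmod_Z n : cmod (Z n) = 1 - depth R n.
Proof. by apply: cmod_zero_pt => i; rewrite ?cmod_anchor ?depth_le_half. Qed.

Let sqrB_Z n : depth R n <= 1 - cmod (Z n) ^+ 2 <= 2 * depth R n.
Proof.
rewrite cmod_Z; have := depth_gt0 R n; have := depth_le_half R n => h1 h2.
by apply/andP; split; nra.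
Qed.

Let poisson_ge0 zeta n : 0 <= poisson zeta n.
Proof.
have /andP[h _] := sqrB_Z n; have := depth_gt0 R n => d0.
by rewrite divr_ge0 ?sqr_ge0 // (le_trans (ltW d0)).
Qed.

(** A point of the Cantor set lies above some zero of every level, at a distance
    comparable with the depth of that zero: the terms are unbounded. *)
Lemma exceptional_cayley t :
  (forall m, exists x, [/\ 0 <= x, x < 1 & `|t - G x| <= 4^-1 ^+ m]) ->
  exceptional_set Z (cayley t).
Proof.
move=> tG; split; first exact: cmod_cayley.
apply/eqyP => A A0.
pose m := Num.bound (136 * A).
have mA : A <= 4 ^+ m / 136.
  rewrite ler_pdivlMr // mulrC.
  have /archi_boundP/ltW h : 0 <= 136 * A by rewrite mulr_ge0 // ltW.
  apply: le_trans h _; rewrite -natrX ler_nat -/m.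
  by rewrite ltnW // ltn_expl.
have [x [x0 x1 tx]] := tG m; have [i lm xi] := dyadic_dense GP m x0 x1.
have ti : cmod (cayley t - anchor i) <= 4 * 4^-1 ^+ m.
  apply: le_trans (cayley_lipschitz _ _) _.
  have := ler_distD (G x) t (G (dyadic R i)).
  have : 0 <= 4^-1 ^+ m :> R by rewrite exprn_ge0 // invr_ge0.
  by move: tx xi; move: (4^-1 ^+ m) `|_| `|_| `|_| => *; lra.
have hd := depth_level R i; rewrite lm in hd.
have d0 := depth_gt0 R i.
have far : cmod (cayley t - Z i) ^+ 2 <= 17 * (4^-1 ^+ m) ^+ 2.
  apply: le_trans (_ : depth R i ^+ 2 + cmod (cayley t - anchor i) ^+ 2 <= _).
    by apply: sqr_dist_zero_le; rewrite ?cmod_cayley ?cmod_anchor // ltW.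
  have := cmod_ge0 (cayley t - anchor i).
  by move: hd d0 ti; move: (depth R i) (cmod _) (4^-1 ^+ m) => d c q /andP[? ?] *; nra.
have Zpos : 0 < cmod (cayley t - Z i).
  apply: lt_le_trans d0 _.
  apply: dist_zero_ge_depth; rewrite ?cmod_cayley ?cmod_anchor ?depth_le_half //.
  by rewrite ltW // depth_gt0.
have term : A <= poisson (cayley t) i.
  apply: le_trans mA _; rewrite /poisson ler_pdivlMr ?exprn_gt0 //.
  have /andP[h _] := sqrB_Z i; apply: le_trans h.
  have q0 : 0 < 4^-1 ^+ m :> R by rewrite exprn_gt0 // invr_gt0.
  have -> : 4 ^+ m = (4^-1 ^+ m)^-1 :> R by rewrite exprVn invrK.
  apply: le_trans (_ : (4^-1 ^+ m)^-1 / 136 * (17 * (4^-1 ^+ m) ^+ 2) <= _).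
    by rewrite ler_wpM2l // divr_ge0 // invr_ge0 ltW.
  case/andP: hd => hd _; apply: le_trans hd.
  move: (4^-1 ^+ m) q0 => q q0.
  have -> : q^-1 / 136 * (17 * q ^+ 2) = q / 8 by field; rewrite lt0r_neq0.
  by [].
apply: le_trans (_ : (\sum_(0 <= n < i.+1) (poisson (cayley t) n)%:E <= _)%E); last first.
  by apply: nneseries_lim_ge => n _ _; rewrite lee_fin poisson_ge0.
rewrite sumEFin lee_fin big_nat_recr //=; apply: le_trans term _.
by rewrite lerDr sumr_ge0 // => n _; exact: poisson_ge0.
Qed.

(** Away from the anchors the Poisson terms are bounded by multiples of the
    depths, which are summable. *)
Lemma exceptional_near_anchor zeta : exceptional_set Z zeta ->
  exists i, cmod (zeta - anchor i) <= 1 / 4.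
Proof.
move=> [z1 zsum]; apply: contrapT => far.
have {}far i : 1 / 4 < cmod (zeta - anchor i).
  by rewrite ltNge; apply/negP => h; apply: far; exists i.
have term n : poisson zeta n <= 128 * (514 / n.+1%:R - 514 / n.+2%:R).
  have d0 := depth_gt0 R n.
  have h1 : 1 / 8 <= cmod (zeta - Z n).
    apply: le_trans (_ : cmod (zeta - anchor n) / 2 <= _); first by have := far n; lra.
    by apply: dist_zero_ge_half; rewrite ?cmod_anchor ?depth_le_half.
  rewrite /poisson ler_pdivrMr ?exprn_gt0 //; last by lra.
  have /andP[_ h2] := sqrB_Z n; apply: le_trans h2 _.
  have h3 := depth_height_sum R n; have h4 := depth_le_height R n.
  move: h3; set s := (514 / _ - _ : R) => h3; move: (cmod _) h1 => c h1.
  have h5 : 1 / 64 <= c ^+ 2 by nra.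
  have s0 : 0 <= s by lra.
  by have := ler_wpM2l s0 h5; lra.
have [A [A0 termA]] : exists A, 0 <= A /\
    forall n, poisson zeta n <= A / n.+1%:R - A / n.+2%:R.
  exists (128 * 514); split=> [|n]; first by rewrite mulr_ge0 ?ler0n.
  by rewrite -!mulrA -mulrBr; exact: term.
suff : (\sum_(0 <= n <oo) (poisson zeta n)%:E <= A%:E)%E.
  by rewrite leNgt zsum ltry.
apply: lime_le; first by apply: is_cvg_nneseries => n _ _; rewrite lee_fin poisson_ge0.
apply: nearW => N; rewrite sumEFin lee_fin.
apply: le_trans (_ : A - A / N.+1%:R <= _); last by rewrite gerBl divr_ge0.
elim: N => [|N IH]; first by rewrite big_geq // divr1 subrr.
rewrite big_nat_recr //=; apply: le_trans (lerD IH (termA N)) _.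
by rewrite addrA subrK.
Qed.

(** All the anchors lie in an arc of diameter at most [1/4]. *)
Lemma exceptional_diameter zeta xi : exceptional_set Z zeta -> exceptional_set Z xi ->
  cmod (zeta - xi) <= 1.
Proof.
move=> /exceptional_near_anchor[i hi] /exceptional_near_anchor[j hj].
have := dist_anchor_le GP i j.
have := cmodB_trans (anchor i) zeta xi; have := cmodB_trans (anchor j) (anchor i) xi.
by move: hj; rewrite [cmod (xi - _)]cmodB; lra.
Qed.

End ExceptionalSet.

(** * Energy and capacity *)

Section IntegralComparison.
Local Open Scope ereal_scope.
Context d (T : measurableType d) (R : realType).
Variable mu : {measure set T -> \bar R}.

(** The integral of a nonnegative function is a supremum over the simple
    functions below it, so comparison holds for arbitrary functions. *)
Lemma le_integral_ge0 (f g : T -> \bar R) : (forall x, 0 <= g x) ->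
  (forall x, f x <= g x) -> \int[mu]_x f x <= \int[mu]_x g x.
Proof.
move=> g0 fg; rewrite integralE.
have fg' x : f^\+ x <= g x by rewrite funeposE ge_max fg g0.
apply: (@le_trans _ _ (\int[mu]_x f^\+ x)).
  by rewrite geeDl // oppe_le0 integral_ge0.
rewrite !ge0_integralTE //; apply: ereal_sup_le => _ [h hf <-].
by exists h => // x; apply: le_trans (hf x) (fg' x).
Qed.

(** The negative part is at most the function equal to [+oo] on the null set and to
    [0] elsewhere, whose integral vanishes. *)
Lemma integral_ge0_off_null (f : T -> \bar R) (N : set T) : measurable N ->
  mu N = 0 -> (forall x, ~ N x -> 0 <= f x) -> 0 <= \int[mu]_x f x.
Proof.
move=> mN N0 f0; rewrite integralE.
have -> : \int[mu]_x f^\- x = 0; last by rewrite sube0 integral_ge0.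
apply/eqP; rewrite eq_le integral_ge0 // andbT.
have <- : \int[mu]_(x in N) cst +oo x = 0 by rewrite integral_cst // N0 mule0.
rewrite [leRHS]integral_mkcond; apply: le_integral_ge0 => x;
  rewrite patchE; case: ifPn => // xN; rewrite ?leey //.
rewrite notin_setE in xN; have h := f0 x xN.
by rewrite funenegE ge_max lexx andbT leeNl oppe0.
Qed.

End IntegralComparison.

Section PlaneTopology.
Variable R : realType.

Lemma measurable_disk (xi : R[i]) (r : R) : 0 < r ->
  measurable ([set zeta | cmod (zeta - xi) < r] : set (borelC R)).
Proof.
move=> r0; apply: sub_sigma_algebra.
have -> : [set zeta : R[i] | cmod (zeta - xi) < r] = ball xi (r%:C).
  apply/seteqP; split => z /=; rewrite -ball_normE /= normr_cmod ltcR cmodB //.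
by apply: ball_open; rewrite ltcR.
Qed.

Lemma measurable_compactC (K : set R[i]) : compact K ->
  measurable (~` K : set (borelC R)).
Proof.
move=> cK; apply: sub_sigma_algebra; apply: closed_openC.
by apply: compact_closed => //; exact: norm_hausdorff.
Qed.

Lemma cayley_continuous : continuous (@cayley R).
Proof.
move=> t; apply/cvgrPdist_lt => e e0.
have eE : e = (complex.Re e)%:C by rewrite RRe_real // gtr0_real.
have e0' : 0 < complex.Re e / 2 by rewrite divr_gt0 // -ltcR -eE.
have := @nbhsx_ballx _ _ t _ e0'.
apply: filterS => s; rewrite -ball_normE /= => ts.
rewrite normr_cmod eE ltcR; apply: le_lt_trans (cayley_lipschitz _ _) _.
by rewrite mulrC -ltr_pdivlMr.
Qed.

End PlaneTopology.

Section CantorMeasure.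
Variables (R : realType) (G : R -> R).
Hypothesis GP : forall x m, `|cantor_sum m x - G x| <= (`|x| + 1) * 2^-1 ^+ m.

Lemma half_gt0 : 0 < 1 / 2 :> R.
Proof. by rewrite divr_gt0. Qed.

(** Restricting to half of the unit interval avoids the jump of [G] at [1], where
    no anchor is attached. *)
Let P := uniform_prob half_gt0.

Let Phi : measurableTypeR R -> borelC R := fun x => cayley (G x).

Let measurable_Phi : measurable_fun setT Phi.
Proof.
apply: (@measurability _ _ _ (borelC R) _ _ (@open R[i])) => // _ [U oU <-].
rewrite setTI; have -> : Phi @^-1` U = G @^-1` (@cayley R @^-1` U) by [].
rewrite -[X in measurable X]setTI; apply: nondecreasing_measurable => //.
  by move=> x y; exact: le_cantor_limit.
apply: open_measurable; apply: open_comp => // x _.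
exact: cayley_continuous.
Qed.

HB.instance Definition _ := isMeasurableFun.Build _ _ _ _ Phi measurable_Phi.

Let mu : probability (borelC R) R := distribution P Phi.

Let K := @cayley R @` closure (G @` `[0, 1 / 2]).

Lemma compact_K : compact K.
Proof.
apply: continuous_compact; first exact/continuous_subspaceT/cayley_continuous.
apply: subclosed_compact (@closed_closure _ _) (@segment_compact R 0 (1 / 8)) _.
have GI : G @` `[0, 1 / 2] `<=` `[0, 1 / 8].
  move=> _ [x xI <-]; move: xI; rewrite /= in_itv /= => /andP[x0 x1].
  by rewrite /= in_itv /=; apply: cantor_limit_range => //; lra.
apply: subset_trans (closure_subset GI) _.
by rewrite -(iffLR (closure_id _)) //; exact: interval_closed.
Qed.

Lemma K_exceptional : K `<=` exceptional_set (cantor_zero G).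
Proof.
move=> _ [t tG <-]; apply: exceptional_cayley => // m.
have e0 : 0 < 4^-1 ^+ m :> R by rewrite exprn_gt0 // invr_gt0.
have [_ [[x xI <-]]] := tG _ (nbhsx_ballx t _ e0).
rewrite -ball_normE /= => /ltW tx; move: xI; rewrite /= in_itv /= => /andP[x0 x1].
by exists x; split=> //; lra.
Qed.

Lemma mu_KC : mu (~` K) = 0%E.
Proof.
rewrite /mu /distribution /pushforward /= /P /uniform_prob integral_uniform_pdf.
rewrite (_ : _ `&` _ = set0) ?integral_set0 //.
apply/seteqP; split=> // x [nK x01]; apply: nK.
exists (G x) => //; apply: subset_closure.
by exists x.
Qed.

(** Two points sent into the same disk of radius [4 * 4 ^ -i] are at distance at
    most [32 * 2 ^ -i], so the preimage of the disk lies in a short interval. *)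
Lemma mu_disk_le (xi : R[i]) i :
  (mu [set zeta | (cmod (zeta - xi) < 4 * 4^-1 ^+ i)%R] <= (128 * 2^-1 ^+ i)%:E)%E.
Proof.
set B := [set _ | _]; pose r : R := 32 * 2^-1 ^+ i.
have r0 : 0 <= r by rewrite mulr_ge0 // exprn_ge0 // invr_ge0.
have q2 : (2^-1 ^+ i) ^+ 2 = 4^-1 ^+ i :> R.
  by rewrite exprAC; congr (_ ^+ _); field.
rewrite /mu /distribution /pushforward /= /P /uniform_prob integral_uniform_pdf.
set S := _ `&` _.
have [[x0 x0S]|/set0P/negP] := pselect (S !=set0); last first.
  rewrite negbK => /eqP ->; rewrite integral_set0.
  by rewrite lee_fin !mulr_ge0 // exprn_ge0 // invr_ge0.
have SI : S `<=` `[x0 - r, x0 + r].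
  move=> x [xB x01]; case: x0S => x0B x001.
  rewrite /= in_itv /= -ler_distlC.
  move: x01 x001; rewrite /= !in_itv /= => /andP[xa xb] /andP[x0a x0b].
  have dx : `|x0 - x| <= 1 by rewrite ler_norml; apply/andP; split; lra.
  have := cantor_limit_expand GP dx.
  have rg y : 0 <= y -> y <= 1 / 2 -> `|G y| <= 1.
    move=> y0 y1; have y1' : y <= 1 by lra.
    have /andP[g0 g1] := cantor_limit_range GP y0 y1'.
    by rewrite ger0_norm //; lra.
  have h1 := cayley_expand (rg _ x0a x0b) (rg _ xa xb).
  have h2 := cmodB_trans xi (cayley (G x0)) (cayley (G x)).
  rewrite [cmod (xi - _)]cmodB in h2.
  have h3 : cmod (cayley (G x0) - xi) < 4 * 4^-1 ^+ i := x0B.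
  have h4 : cmod (cayley (G x) - xi) < 4 * 4^-1 ^+ i := xB.
  move=> h5.
  rewrite -ler_sqr ?nnegrE // real_normK ?num_real // /r exprMn q2.
  have : 0 <= 4^-1 ^+ i :> R by rewrite exprn_ge0 // invr_ge0.
  by move: h1 h2 h3 h4 h5; move: (4^-1 ^+ i) => q; lra.
have mS : measurable S.
  apply: measurableI => //.
  rewrite -[X in measurable X]setTI; apply: measurable_Phi => //.
  by apply: measurable_disk; rewrite mulr_gt0 // exprn_gt0 // invr_gt0.
apply: (@le_trans _ _ (\int[lebesgue_measure]_(x in S) (cst 2%:E x))%E).
  apply: ge0_le_integral => //=.
  - by move=> x _; rewrite lee_fin uniform_pdf_ge0.
  - by apply/measurable_EFinP/measurable_funTS; exact: measurable_uniform_pdf.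
  - move=> x [_]; rewrite /= in_itv /= => x01.
    by rewrite /uniform_pdf x01 lee_fin subr0 div1r invrK.
rewrite integral_cst //.
have mI : measurable (`[x0 - r, x0 + r]%classic : set (measurableTypeR R)) by [].
have := @le_measure _ _ _ (@lebesgue_measure R) S `[x0 - r, x0 + r]%classic.
rewrite !inE => /(_ mS mI SI) h.
apply: (@le_trans _ _ (2%:E * lebesgue_measure `[(x0 - r)%R, (x0 + r)%R]%classic)%E).
  by rewrite lee_pmul2l.
rewrite lebesgue_measure_itv /= lte_fin.
case: ifPn => _; last by rewrite mule0 lee_fin mulr_ge0 // exprn_ge0 // invr_ge0.
by rewrite -EFinB -EFinM lee_fin /r; move: (2^-1 ^+ i) => q; lra.
Qed.

(** The count of the disks about [xi] that contain [zeta] dominates the kernel,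
    including on the diagonal where all the disks contain [zeta]. *)
Lemma log_kernel_le (xi zeta : R[i]) : (log_kernel zeta xi <= \sum_(0 <= i <oo)
  (3 * \1_[set z : R[i] | (cmod (z - xi) < 4 * 4^-1 ^+ i)%R] zeta)%:E)%E.
Proof.
pose F i : \bar R := (3 * \1_[set z : R[i] | cmod (z - xi) < 4 * 4^-1 ^+ i] zeta)%:E.
change (log_kernel zeta xi <= \sum_(0 <= i <oo) F i)%E.
have F0 n : (0 <= F n)%E by rewrite lee_fin mulr_ge0 // indicE ler0n.
have low N : (forall i, (i < N)%N -> cmod (zeta - xi) < 4 * 4^-1 ^+ i) ->
    ((3 * N%:R)%:E <= \sum_(0 <= i <oo) F i)%E.
  move=> h; apply: le_trans (_ : (\sum_(0 <= i < N) F i <= _)%E); last first.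
    by apply: nneseries_lim_ge => n _ _; exact: F0.
  rewrite sumEFin lee_fin big_nat.
  rewrite (eq_bigr (fun=> 3)) => [|i /andP[_ iN]].
    by rewrite -big_nat sumr_const_nat subn0 mulr_natr.
  by rewrite indicE mem_set ?mulr1 //=; exact: h.
rewrite /log_kernel; case: eqVneq => [zx|zx].
  have -> : (\sum_(0 <= i <oo) F i = +oo)%E; last by [].
  apply/eqyP => A A0.
  apply: le_trans (low (Num.bound A) _) => [|i _].
    rewrite lee_fin; have := archi_boundP (ltW A0); lra.
  by rewrite zx subrr cmod0 mulr_gt0 // exprn_gt0 // invr_gt0.
have s0 : 0 < cmod (zeta - xi) by rewrite cmod_gt0 subr_eq0.
move: (cmod _) s0 low => s s0 low.
have ex : exists n, 4 * 4^-1 ^+ n <= s.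
  exists (Num.bound (4 / s)).
  have h0 : 0 <= 4 / s by rewrite divr_ge0 // ltW.
  rewrite exprVn ler_pdivrMr ?exprn_gt0 // mulrC -ler_pdivrMr //.
  apply: le_trans (ltW (archi_boundP h0)) _.
  by rewrite -natrX ler_nat ltnW // ltn_expl.
case: (ex_minnP ex) => N Ns Nmin.
apply: le_trans (low N _) => [|i iN]; last first.
  by rewrite ltNge; apply/negP => /Nmin; rewrite leqNgt iN.
rewrite lee_fin div1r.
have q0 : 0 < 4^-1 ^+ N :> R by rewrite exprn_gt0 // invr_gt0.
apply: le_trans (_ : ln (4 ^+ N) <= _).
  have -> : 4 ^+ N = (4^-1 ^+ N)^-1 :> R by rewrite exprVn invrK.
  rewrite ler_ln ?posrE ?invr_gt0 // lef_pV2 ?posrE //.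
  by move: Ns q0; move: (4^-1 ^+ N) => q; lra.
rewrite lnXn // -[ln 4 *+ N]mulr_natr ler_wpM2r //.
have -> : 4 = 1 + 3 :> R by ring.
by apply: le_ln1Dx; lra.
Qed.

(** The logarithmic potential is bounded on the whole plane, by summing the masses
    of the disks. *)
Lemma log_energy_cantor : (log_energy mu < +oo)%E.
Proof.
pose D (xi : R[i]) i : set (borelC R) := [set z | cmod (z - xi) < 4 * 4^-1 ^+ i].
have mD xi i : measurable (D xi i).
  by apply: measurable_disk; rewrite mulr_gt0 // exprn_gt0 // invr_gt0.
have [C C0 potential] : exists2 C : R, 0 < C &
    forall xi, (\int[mu]_zeta log_kernel zeta xi <= C%:E)%E.
  exists 768 => [|xi]; first by rewrite ltr0n.
  apply: le_trans (le_integral_ge0 mu _ (log_kernel_le xi)) _.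
    by move=> z; apply: nneseries_ge0 => n _ _; rewrite lee_fin mulr_ge0 // indicE.
  rewrite integral_nneseries //=; last first.
    move=> n; apply/measurable_EFinP; apply: measurable_funM => //.
    exact: measurable_indic (mD xi n).
  apply: lime_le.
    apply: is_cvg_nneseries => n _ _; apply: integral_ge0 => z _.
    by rewrite lee_fin mulr_ge0 // indicE.
  apply: nearW => N.
  apply: le_trans (_ : \sum_(0 <= i < N) (384 * 2^-1 ^+ i)%:E <= _)%E.
    apply: lee_sum => i _.
    under eq_integral do rewrite EFinM.
    rewrite ge0_integralZl_EFin //; last first.
      by apply/measurable_EFinP; exact: measurable_indic (mD xi i).
    rewrite integral_indic //; last exact: mD.
    rewrite setIT; apply: le_trans (_ : 3%:E * (128 * 2^-1 ^+ i)%:E <= _)%E.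
      by rewrite lee_pmul2l //; exact: mu_disk_le.
    by rewrite -EFinM lee_fin mulrA; move: (2^-1 ^+ i) => q; lra.
  rewrite sumEFin lee_fin -mulr_sumr.
  have h0 : 0 <= 2^-1 :> R by rewrite invr_ge0.
  have h1 : 2^-1 < 1 :> R by lra.
  have e : (1 - 2^-1)^-1 = 2 :> R by field; lra.
  have := sum_geom_le 0 N h0 h1; rewrite expr0 mul1r e.
  by move: (\sum_(_ <= _ < _) _) => s; lra.
apply: le_lt_trans (_ : (C%:E < +oo)%E); last exact: ltry.
apply: le_trans (le_integral_ge0 mu _ potential) _; first by move=> x; rewrite lee_fin ltW.
rewrite integral_cst // -[leRHS]mule1 lee_pmul2l //.
exact: probability_le1.
Qed.

Lemma log_kernel_ge0 (zeta xi : R[i]) : cmod (zeta - xi) <= 1 ->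
  (0 <= log_kernel zeta xi)%E.
Proof.
move=> d1; rewrite /log_kernel; case: eqVneq => // zx.
have d0 : 0 < cmod (zeta - xi) by rewrite cmod_gt0 subr_eq0.
by rewrite lee_fin ln_ge0 // div1r invf_ge1.
Qed.

(** The kernel is nonnegative at distances at most [1], and the exceptional set
    has diameter at most [1]. *)
Lemma log_energy_exceptional_ge0 (nu : probability (borelC R) R) :
  compact_probabilities (exceptional_set (cantor_zero G)) nu -> (0 <= log_energy nu)%E.
Proof.
move=> [L [cL LE nuL]].
apply: (integral_ge0_off_null (measurable_compactC cL) nuL) => xi /contrapT Lxi.
apply: (integral_ge0_off_null (measurable_compactC cL) nuL) => zeta /contrapT Lzeta.
by apply: log_kernel_ge0; apply: (exceptional_diameter GP); exact: LE.
Qed.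

Lemma log_capacity_exceptional_gt0 : (0 < log_capacity (exceptional_set (cantor_zero G)))%E.
Proof.
rewrite /log_capacity; set I := ereal_inf _.
have I0 : (0 <= I)%E.
  by apply: le_ereal_inf_tmp => _ [nu nuE <-]; exact: log_energy_exceptional_ge0.
have Iy : (I < +oo)%E.
  apply: le_lt_trans log_energy_cantor; apply: ereal_inf_lbound; exists mu => //.
  by exists K; split; [exact: compact_K|exact: K_exceptional|exact: mu_KC].
have [->|I1] := eqVneq I 0%E; first by rewrite inve0 ltry.
have Iy0 : I != +oo%E by rewrite lt_eqF.
by rewrite inve_gt0 // lt_neqAle eq_sym I1.
Qed.

End CantorMeasure.

Theorem proposition4p2 (R : realType) :
  exists z : nat -> R[i],
    zero_set_Dirichlet z /\ (0 < log_capacity (exceptional_set z))%E.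
Proof.
have [G GP] := @cantor_limit_exists R.
exists (cantor_zero G); split; first exact: zero_set_cantor_zero.
exact: log_capacity_exceptional_gt0.
Qed.
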